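(* Let $X$ be a separable Banach space. Then either $X$ contains continuum many mutually non-equivalent spreading models, or $X$ contains at most countably many mutually non-equivalent spreading models. When $X^*$ is separable, the same dichotomy holds for the spreading models generated by weakly null seminormalized basic sequences in $X$; when $X$ has a Schauder basis, the same dichotomy holds for the spreading models generated by seminormalized block basic sequences of the basis.
   Context: Scalars are real. A sequence $\{x_i\}$ in $X$ is seminormalized if there are $0<c<C$ with $c<\|x_i\|<C$ for all $i$. A seminormalized basic sequence $\{x_i\}$ in $X$ generates a spreading model if for all $k$ and all $r_0,\ldots,r_k\in\mathbb R$ the limit $$\lim_{l_0<\ldots<l_k,\ l_0\to\infty}\|r_0x_{l_0}+\cdots+r_kx_{l_k}\|$$ exists; its spreading model is then the sequence $\{\tilde x_i\}$ whose linear span carries the norm for which $\|r_0\tilde x_0+\cdots+r_k\tilde x_k\|$ equals this limit. The spreading models contained in $X$ are those generated by seminormalized basic sequences in $X$. Two spreading models (being basic sequences) $\{\tilde x_i\},\{\tilde y_i\}$ are equivalent if there is $C\ge 1$ with $C^{-1}\|\sum a_i \tilde x_i\|\le\|\sum a_i \tilde y_i\|\le C\|\sum a_i \tilde x_i\|$ for all finitely supported scalar sequences $(a_i)$. A block basic sequence of a basis is a sequence of nonzero finite linear combinations of the basis vectors with successive supports. *)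

(* Defs.v *)
From HB Require Import structures.
From mathcomp Require Import all_boot all_order all_algebra.
From mathcomp Require Import all_classical all_reals all_analysis.

Set Implicit Arguments.
Unset Strict Implicit.
Unset Printing Implicit Defensive.

Import Order.TTheory GRing.Theory Num.Theory.
Import numFieldNormedType.Exports.

Local Open Scope classical_set_scope.
Local Open Scope ring_scope.

(* Finitely supported scalar sequences (p_i) are encoded as polynomials p, with
   p_i the coefficient p`_i; the i-th unit vector is 'X^i. *)
Definition lin_comb (R : realType) (X : normedModType R) (x : nat -> X)
    (p : {poly R}) : X :=
  \sum_(i < size p) p`_i *: x i.

Definition separable (T : topologicalType) : Prop :=
  exists D : set T, countable D /\ dense D.

(* Intended for continuous linear f only: sup is 0 on unbounded sets. *)
Definition dual_norm (R : realType) (X : normedModType R) (f : X -> R) : R :=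
  sup [set `|f x| | x in [set x | `|x| <= 1]].

Definition separable_dual (R : realType) (X : normedModType R) : Prop :=
  exists D : set {linear X -> R^o},
    [/\ countable D,
        forall g, D g -> continuous g
      & forall f : {linear X -> R^o}, continuous f ->
          forall eps : R, 0 < eps ->
            exists2 g, D g & dual_norm (f \- g) < eps].

Definition weakly_null (R : realType) (X : normedModType R) (x : nat -> X) :
    Prop :=
  forall f : {linear X -> R^o}, continuous f -> f (x n) @[n --> \oo] --> 0.

Definition schauder_basis_of (R : realType) (X : normedModType R)
    (Y : set X) (e : nat -> X) : Prop :=
  (forall i, Y (e i)) /\
  (forall y, Y y ->
    exists! a : nat -> R, series (fun i => a i *: e i) @ \oo --> y).

Definition schauder_basis (R : realType) (X : normedModType R)
    (e : nat -> X) : Prop :=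
  schauder_basis_of setT e.

Definition basic_sequence (R : realType) (X : normedModType R)
    (x : nat -> X) : Prop :=
  schauder_basis_of (closure (range (lin_comb x))) x.

Definition seminormalized (R : realType) (X : normedModType R)
    (x : nat -> X) : Prop :=
  exists c C : R, [/\ 0 < c, c < C & forall i, c < `|x i| < C].

Definition block_sequence (R : realType) (X : normedModType R)
    (e x : nat -> X) : Prop :=
  exists b : nat -> {poly R},
    [/\ forall n, x n = lin_comb e (b n),
        forall n, x n != 0
      & forall n i j, (b n)`_i != 0 -> (b n.+1)`_j != 0 -> (i < j)%N].

(* The filter "l_0 < ... < l_k, l_0 -> oo". *)
Definition increasing_tuples (k : nat) : set_system ('I_k.+1 -> nat) :=
  filter_from [set: nat] (fun N =>
    [set l | (N <= l ord0)%N /\ forall i j : 'I_k.+1, (i < j)%N -> (l i < l j)%N]).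
Arguments increasing_tuples k : clear implicits.

Instance increasing_tuples_proper_filter (k : nat) :
  ProperFilter (increasing_tuples k).
Proof.
apply: filter_from_proper.
  apply: filter_from_filter; first by exists 0%N.
  move=> M N _ _; exists (maxn M N) => // l [lMN lincr].
  by move: lMN; rewrite geq_max => /andP[].
move=> N _; exists (fun i => N + i)%N; split => /= [|i j ij].
  exact: leq_addr.
by rewrite ltn_add2l.
Qed.

(* A spreading model (xt_i) is represented by the norm rho of its linear span,
   the latter being identified with the finitely supported sequences by sending
   xt_i to 'X^i. That rho is a norm follows from the conditions on x. *)
Definition generates_spreading_model (R : realType) (X : normedModType R)
    (x : nat -> X) (rho : {poly R} -> R) : Prop :=
  [/\ seminormalized x,
      basic_sequence x
    & forall (k : nat) (r : 'I_k.+1 -> R),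
        `|\sum_(i < k.+1) r i *: x (l i)| @[l --> increasing_tuples k] -->
        rho (\sum_(i < k.+1) r i *: 'X^i)].

Definition spreading_models (R : realType) (X : normedModType R) :
    set ({poly R} -> R) :=
  [set rho | exists x : nat -> X, generates_spreading_model x rho].

Definition weakly_null_spreading_models (R : realType) (X : normedModType R) :
    set ({poly R} -> R) :=
  [set rho | exists x : nat -> X,
    weakly_null x /\ generates_spreading_model x rho].

Definition block_spreading_models (R : realType) (X : normedModType R)
    (e : nat -> X) : set ({poly R} -> R) :=
  [set rho | exists x : nat -> X,
    block_sequence e x /\ generates_spreading_model x rho].

Definition equivalent (R : realType) (rho sigma : {poly R} -> R) : Prop :=
  exists C : R, 1 <= C /\
    forall a : {poly R}, C^-1 * rho a <= sigma a <= C * rho a.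

Definition mutually_nonequivalent (R : realType) (F : set ({poly R} -> R)) :
    Prop :=
  forall rho sigma, F rho -> F sigma -> rho <> sigma -> ~ equivalent rho sigma.

Definition continuum_many_nonequivalent (R : realType)
    (S : set ({poly R} -> R)) : Prop :=
  exists F : set ({poly R} -> R),
    [/\ F `<=` S, mutually_nonequivalent F & (F #= [set: R])%card].

Definition countably_many_nonequivalent (R : realType)
    (S : set ({poly R} -> R)) : Prop :=
  forall F : set ({poly R} -> R),
    F `<=` S -> mutually_nonequivalent F -> countable F.

Definition dichotomy (R : realType) (S : set ({poly R} -> R)) : Prop :=
  continuum_many_nonequivalent S \/ countably_many_nonequivalent S.

(* Main.v *)
Require Import Defs.
From HB Require Import structures.
From mathcomp Require Import all_boot all_order all_algebra.
From mathcomp Require Import all_classical all_reals all_analysis ring lra.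

Set Implicit Arguments.
Unset Strict Implicit.
Unset Printing Implicit Defensive.

Import Order.TTheory GRing.Theory Num.Theory.
Import numFieldNormedType.Exports.

Local Open Scope classical_set_scope.
Local Open Scope ring_scope.

(** Equivalence of spreading models is the increasing union over n of the closed
    relations "the two norms are equivalent with constant n + 1". A spreading model
    is coded by a sequence of naturals listing approximations of the generating
    sequence in a dense subset of X, together with naturals witnessing each defining
    property: norm bounds, a basis constant, a modulus of convergence for the limit
    of norms, a modulus of weak nullness on a dense subset of the dual, the supports
    of the blocks. These witnesses turn the set of codes into a closed set on which
    the norm of the spreading model depends continuously. For such a union of closed
    relations on a closed subset of the Baire space, Silver's dichotomy is
    elementary: if some independent set is uncountable then, off the countably many
    cylinders all of whose independent sets are countable, every cylinder contains a
    point inequivalent to any given one, so a Cantor scheme can separate its nodes at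
    level n for the n-th relation. *)

(** * Silver dichotomy for unions of closed relations *)

Definition agree (m : nat) (a b : nat -> nat) :=
  forall i, (i < m)%N -> a i = b i.

Definition cylinder (s : seq nat) (a : nat -> nat) := agree (size s) a (nth 0%N s).

Lemma agree_sym m a b : agree m a b -> agree m b a.
Proof. by move=> ab i im; rewrite ab. Qed.

Lemma agree_trans m a b c : agree m a b -> agree m b c -> agree m a c.
Proof. by move=> ab bc i im; rewrite ab// bc. Qed.

Lemma agree_le m n a b : (m <= n)%N -> agree n a b -> agree m a b.
Proof. by move=> mn ab i im; rewrite ab// (leq_trans im). Qed.

Lemma agree_mkseq m a : agree m a (nth 0%N (mkseq a m)).
Proof. by move=> i im; rewrite nth_mkseq. Qed.

Lemma cylinder_mkseq m a b : cylinder (mkseq a m) b <-> agree m b a.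
Proof.
rewrite /cylinder size_mkseq; split => h.
  exact: agree_trans h (agree_sym (agree_mkseq _)).
exact: agree_trans h (agree_mkseq _).
Qed.

Lemma uncountable_subsingletonD (T : Type) (F N : set T) :
  countable N -> (forall t u, (F `\` N) t -> (F `\` N) u -> t = u) ->
  countable F.
Proof.
move=> cN sub; have [[t FNt]|noFN] := pselect (exists t, (F `\` N) t).
  apply: (@sub_countable _ _ _ (\bigcup_(b : bool) if b then N else [set t])).
    apply: subset_card_le => u Fu; have [Nu|nNu] := pselect (N u).
      by exists true.
    by exists false => //=; apply: sub.
  by apply: bigcup_countable => // -[] _ //; exact: countable1.
apply: (@sub_countable _ _ _ N) => //; apply: subset_card_le => u Fu.
by apply: contra_notP noFN => nNu; exists u.
Qed.

Section Silver.
(** [G a t] reads: [a] is a code of [t]. [G_closed] asks that a limit of codes be a code of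
    something; continuity of the coded object enters through [E_closed], where coded objects are
    compared. *)
Variables (T : Type) (G : (nat -> nat) -> T -> Prop) (E : nat -> T -> T -> Prop).

Let S := [set t | exists a, G a t].
Let equiv t u := exists n, E n t u.
Let independent (F : set T) := forall t u, F t -> F u -> t <> u -> ~ equiv t u.

Hypothesis G_closed : forall a,
  (forall m, exists b t, agree m b a /\ G b t) -> exists t, G a t.
Hypothesis E_closed : forall n a b t u, G a t -> G b u ->
  (forall m, exists a' b' t' u',
    [/\ agree m a' a, agree m b' b, G a' t', G b' u' & E n t' u']) -> E n t u.
Hypothesis E_mono : forall m n t u, S t -> S u -> (m <= n)%N -> E m t u -> E n t u.
Hypothesis E_sym : forall n t u, E n t u -> E n u t.
Hypothesis E_trans : forall t u v, S t -> S u -> S v ->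
  equiv t u -> equiv u v -> equiv t v.

Let node_set s := [set t | exists a, G a t /\ cylinder s a].
Let small s := forall F, F `<=` node_set s -> independent F -> countable F.
(** Small nodes are indexed by finite sequences, hence countable in number; the kernel is what
    remains once their cylinders are removed. *)
Let kernel a := forall m, ~ small (mkseq a m).

(* If every element outside the small nodes were equivalent to [u], an independent
   set would have at most one such element. *)
Lemma kernel_inequivalent s u : S u -> ~ small s ->
  exists a t, [/\ G a t, cylinder s a, kernel a & ~ equiv t u].
Proof.
move=> Su /existsNP[F] /not_implyP[Fs] /not_implyP[indF ncF].
apply: contra_notP ncF => noneq.
pose N := \bigcup_(s' in [set s' | small s']) (F `&` node_set s').
apply: (@uncountable_subsingletonD _ _ N).
  apply: bigcup_countable; first exact: countableP.
  move=> s' /= sm; apply: sm; first exact: subIsetr.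
  by move=> t v [Ft _] [Fv _]; apply: indF.
have eqv t : (F `\` N) t -> equiv t u /\ S t.
  move=> [Ft Nt]; have [a [Gat sa]] := Fs _ Ft; split; last by exists a.
  apply: contra_notP noneq => neq; exists a, t; split => // m sm.
  apply: Nt; exists (mkseq a m) => //; split => //; exists a; split=> //.
  exact/cylinder_mkseq.
move=> t v FNt FNv; have [tu St] := eqv _ FNt; have [vu Sv] := eqv _ FNv.
have : equiv t v.
  apply: (E_trans St Su Sv tu); have [n En] := vu; exists n; exact: E_sym.
apply: contraPP => tv; apply: indF => //; [exact: FNt.1|exact: FNv.1].
Qed.

Let good s := ~ small s.
(** This says that [s] is a prefix of [s']: the size condition keeps the default entries of [nth]
    out of the comparison. *)
Let refines s s' := (size s <= size s')%N /\ cylinder s (nth 0%N s').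
Let separated n s s' := forall a b t u, cylinder s a -> cylinder s' b ->
  G a t -> G b u -> ~ E n t u.

Lemma refines_refl s : refines s s. Proof. by split. Qed.

Lemma refines_cylinder s s' a : refines s s' -> cylinder s' a -> cylinder s a.
Proof.
move=> [le ss'] s'a; apply: agree_trans ss'.
exact: agree_le s'a.
Qed.

Lemma refines_trans s s' s'' : refines s s' -> refines s' s'' -> refines s s''.
Proof.
move=> ss' [le s's'']; split; first exact: leq_trans ss'.1 le.
exact: refines_cylinder s's''.
Qed.

Lemma refines_mkseq s a m : (size s <= m)%N -> cylinder s a ->
  refines s (mkseq a m).
Proof.
move=> sm sa; split; first by rewrite size_mkseq.
apply: agree_trans sa; apply/agree_sym/agree_le/agree_mkseq; exact: sm.
Qed.

Lemma separated_sub n s s' r r' : refines s r -> refines s' r' ->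
  separated n s s' -> separated n r r'.
Proof.
move=> sr sr' sep a b t u ra rb.
exact: sep (refines_cylinder sr ra) (refines_cylinder sr' rb).
Qed.

Lemma good_nonempty s : good s -> exists a t, G a t /\ cylinder s a.
Proof.
apply: contra_notP => no F Fs _; apply: (@sub_countable _ _ _ (@set0 T)).
  by apply: subset_card_le => t /Fs[a Gsa]; apply: no; exists a, t.
exact: countable0.
Qed.

Lemma good_point s : good s -> exists a, cylinder s a /\ kernel a.
Proof.
move=> gs; have [a [t [Gat _]]] := good_nonempty gs.
have St : S t by exists a.
by have [b [u [_ sb kb _]]] := kernel_inequivalent St gs; exists b.
Qed.

Lemma good_refine s m : good s ->
  exists s', [/\ refines s s', good s' & (m <= size s')%N].
Proof.
move=> /good_point[a [sa ka]]; exists (mkseq a (maxn (size s) m)); split.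
- by apply: refines_mkseq => //; exact: leq_maxl.
- exact: ka.
- by rewrite size_mkseq leq_maxr.
Qed.

(** A kernel point [b] in [s'] codes some [u] by [G_closed], and [kernel_inequivalent] gives a
    kernel point [a] in [s] coding an element not equivalent to [u]. As [E n] is closed, long
    initial segments of [a] and [b] already exclude it, and they are good because both points lie in
    the kernel. *)
Lemma good_separate n s s' : good s -> good s' ->
  exists r r', [/\ refines s r, refines s' r', good r, good r' &
    separated n r r'].
Proof.
move=> gs gs'; have [b [s'b kb]] := good_point gs'.
have [u Gbu] : exists u, G b u.
  apply: G_closed => m.
  have [b' [t [Gt mb']]] := good_nonempty (kb m).
  by exists b', t; split=> //; apply/cylinder_mkseq.
have Su : S u by exists b.
have [a [t [Gat sa ka neq]]] := kernel_inequivalent Su gs.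
have nE : ~ E n t u by move=> tu; apply: neq; exists n.
have /existsNP[m hm] := contra_not (E_closed Gat Gbu) nE.
pose M := maxn m (maxn (size s) (size s')).
have mM : (m <= M)%N by rewrite leq_maxl.
exists (mkseq a M), (mkseq b M); split.
- by apply: refines_mkseq => //; rewrite /M !leq_max leqnn !orbT.
- by apply: refines_mkseq => //; rewrite /M !leq_max leqnn !orbT.
- exact: ka.
- exact: kb.
- move=> a' b' t' u' /cylinder_mkseq aa' /cylinder_mkseq bb' Ga' Gb' tu'.
  by apply: hm; exists a', b', t', u'; split=> //; exact: agree_le mM _.
Qed.

(** The pairs are treated one after the other; by [separated_sub], later refinements do not spoil
    earlier separations. *)
Lemma separate_pairs (I : eqType) n (L : seq (I * I)) (g : I -> seq nat) :
  (forall i, good (g i)) -> all (fun p => p.1 != p.2) L ->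
  exists g', [/\ forall i, good (g' i), forall i, refines (g i) (g' i) &
    forall p, p \in L -> separated n (g' p.1) (g' p.2)].
Proof.
move=> gg; elim: L => [_|[i j] L IH /= /andP[ij /IH[h [gh rh sh]]]].
  by exists g; split.
have [r [r' [ir jr' gr gr' sep]]] := good_separate n (gh i) (gh j).
pose h' k := if k == i then r else if k == j then r' else h k.
have hh' k : refines (h k) (h' k).
  by rewrite /h'; case: eqP => [->//|_]; case: eqP => [->|_]//.
exists h'; split.
- by move=> k; rewrite /h'; case: ifP => // _; case: ifP.
- by move=> k; apply: refines_trans (hh' k); exact: rh.
- move=> p; rewrite inE => /orP[/eqP->/=|pL].
    by rewrite /h' eqxx eq_sym (negbTE ij) eqxx.
  exact: separated_sub (sh p pL).
Qed.

(** One level of the Cantor scheme. Every string first receives the node of its parent, so that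
    siblings start from the same node; then the finitely many pairs of distinct strings of length
    [n] are separated. *)
Lemma scheme_step n (g : seq bool -> seq nat) : (forall s, good (g s)) ->
  exists g', [/\ forall s, good (g' s),
    forall s b, refines (g s) (g' (rcons s b)),
    forall s, (n <= size (g' s))%N &
    forall s t, size s = n -> size t = n -> s != t ->
      separated n (g' s) (g' t)].
Proof.
move=> gg; pose parent (s : seq bool) := take (size s).-1 s.
pose W := [seq val w | w <- enum {: n.-tuple bool}].
pose L := [seq p <- [seq (s, t) | s <- W, t <- W] | p.1 != p.2].
have [||h [gh rh sh]] := @separate_pairs _ n L (fun s => g (parent s)).
- by move=> s; exact: gg.
- exact: filter_all.
have /choice[g' hg'] : forall s, exists s',
    [/\ refines (h s) s', good s' & (n <= size s')%N].
  by move=> s; apply: good_refine.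
exists g'; split.
- by move=> s; have [] := hg' s.
- move=> s b; have [r _ _] := hg' (rcons s b); apply: refines_trans r.
  have := rh (rcons s b); rewrite /parent size_rcons /=.
  by rewrite -cats1 take_size_cat.
- by move=> s; have [] := hg' s.
- move=> s t sn tn st; have [r _ _] := hg' s; have [r' _ _] := hg' t.
  apply: (separated_sub r r'); apply: (sh (s, t)).
  rewrite mem_filter /= st /=; apply/allpairsP; exists (s, t) => /=.
  have mem u : size u = n -> u \in W.
    move=> /eqP un; apply/mapP; exists (Tuple un) => //; exact: mem_enum.
  by rewrite !mem.
Qed.

Theorem closed_graded_dichotomy :
  (exists phi : (nat -> bool) -> T,
    (forall x, S (phi x)) /\
    (forall x y, x <> y -> ~ equiv (phi x) (phi y))) \/
  (forall F, F `<=` S -> independent F -> countable F).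
Proof.
have [sm|gnil] := pselect (small [::]).
  right => F FS indF; apply: sm => // t /FS[a Ga]; exists a; by split.
left.
pose scheme := {g : seq bool -> seq nat | forall s, good (g s)}.
have /choice[step hstep] : forall ng : nat * scheme, exists g' : scheme,
  [/\ forall s b, refines (sval ng.2 s) (sval g' (rcons s b)),
    forall s, (ng.1 <= size (sval g' s))%N &
    forall s t, size s = ng.1 -> size t = ng.1 -> s != t ->
      separated ng.1 (sval g' s) (sval g' t)].
  move=> [n [g gg]]; have [g' [gg' r l sp]] := scheme_step n gg.
  by exists (exist _ g' gg').
pose g0 : scheme := exist (fun g : seq bool -> seq nat => forall s, good (g s))
  (fun=> [::]) (fun=> gnil).
pose fix g n : scheme := if n is n'.+1 then step (n, g n') else step (0%N, g0).
have gsize n s : (n <= size (sval (g n) s))%N.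
  by case: n => [|n] //=; have [_ + _] := hstep (n.+1, g n); apply.
have gsep n s t : size s = n -> size t = n -> s != t ->
    separated n (sval (g n) s) (sval (g n) t).
  case: n => [|n] /=; first by have [_ _] := hstep (0%N, g0); apply.
  by have [_ _] := hstep (n.+1, g n); apply.
have grefine n s b : refines (sval (g n) s) (sval (g n.+1) (rcons s b)).
  by have [+ _ _] := hstep (n.+1, g n); apply.
pose node x n := sval (g n) (mkseq x n).
have nodeS x n k : refines (node x n) (node x (n + k)%N).
  elim: k => [|k IH]; first by rewrite addn0; exact: refines_refl.
  apply: refines_trans IH _; rewrite addnS /node.
  have -> : mkseq x (n + k).+1 = rcons (mkseq x (n + k)) (x (n + k)%N).
    by rewrite /mkseq -addn1 iotaD map_cat /= add0n cats1.
  exact: grefine.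
(* The node at level [i.+1] has length at least [i.+1], so its entry [i] is a genuine one and is
   shared by all later nodes. *)
pose pt x i := nth 0%N (node x i.+1) i.
have node_pt x n : cylinder (node x n) (pt x).
  move=> i ni; rewrite /pt; have [nSi|Sin] := leqP n i.+1.
    have [_ ] := nodeS x n (i.+1 - n)%N; rewrite subnKC// => h.
    by rewrite h.
  have [_ ] := nodeS x i.+1 (n - i.+1)%N; rewrite (subnKC (ltnW Sin)) => h.
  by rewrite h//; exact: gsize.
have node_good x n : good (node x n) by rewrite /node; exact: (svalP (g n)).
have /choice[phi Gphi] : forall x, exists t, G (pt x) t.
  move=> x; apply: G_closed => m.
  have [b [t [Gt mb']]] := good_nonempty (node_good x m).
  exists b, t; split=> //; apply: (agree_le (gsize m (mkseq x m))).
  by apply: agree_trans mb' _; apply: agree_sym; exact: node_pt.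
have Sphi x : S (phi x) by exists (pt x).
exists phi; split=> // x y xy [n En].
have [i xyi] : exists i, x i <> y i.
  by apply: contra_notP xy => no; apply/funext => i; apply: contra_notP no => ?; exists i.
(* At level [N] the strings of [x] and [y] already differ, and [E n] implies [E N] by
   monotonicity. *)
pose N := maxn n i.+1.
have EN : E N (phi x) (phi y) by apply: E_mono En; rewrite ?leq_maxl.
apply: (gsep N (mkseq x N) (mkseq y N) _ _ _ _ _ _ _
  (node_pt x N) (node_pt y N) (Gphi x) (Gphi y) EN).
- by rewrite size_mkseq.
- by rewrite size_mkseq.
- apply/eqP => /(congr1 (nth false ^~ i)); rewrite !nth_mkseq//;
  by rewrite /N leq_max ltnSn orbT.
Qed.

End Silver.

(** * Baire category *)

Lemma cvg_seqP (R : realType) (V : normedModType R) (u : nat -> V) (l : V) :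
  u @ \oo --> l <->
  forall eps, 0 < eps -> exists N, forall n, (N <= n)%N -> `|l - u n| <= eps.
Proof.
split=> [/cvgrPdist_le ul eps e0|ul].
  by have [N _ hN] := ul _ e0; exists N => n Nn; exact: hN.
by apply/cvgrPdist_le => eps e0; have [N hN] := ul _ e0; exists N.
Qed.

Lemma cauchy_seq_cvg (R : realType) (V : completeNormedModType R) (u : nat -> V) :
  (forall eps, 0 < eps -> exists N, forall m n, (N <= m)%N -> (N <= n)%N ->
    `|u m - u n| <= eps) -> exists l : V, u @ \oo --> l.
Proof.
move=> uC; have : cvg ((u @ \oo) : set_system V).
  apply/cauchy_cvgP/cauchy_exP => eps e0.
  have [N hN] := uC (eps / 2) (divr_gt0 e0 (ltr0n _ 2)).
  exists (u N), N => // n /= Nn; rewrite -ball_normE /=.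
  apply: le_lt_trans (hN _ _ (leqnn N) Nn) _.
  by rewrite ltr_pdivrMr// ltr_pMr// ltr1n.
by move=> ul; exists (lim ((u @ \oo) : set_system V)).
Qed.

Lemma cvg_norm_le (R : realType) (V : normedModType R) (u : nat -> V) (l y : V)
    (C : R) N :
  u @ \oo --> l -> (forall n, (N <= n)%N -> `|y - u n| <= C) -> `|y - l| <= C.
Proof.
move=> /cvg_seqP ul uC; apply/ler_addgt0Pr => eps e0.
have [M hM] := ul _ e0; pose n := maxn N M.
have -> : y - l = (y - u n) + - (l - u n) by rewrite opprB addrA subrK.
apply: le_trans (ler_normD _ _) _; rewrite normrN lerD//.
  by apply: uC; exact: leq_maxl.
by apply: hM; exact: leq_maxr.
Qed.

Lemma cvg_closed_mem (R : realType) (V : normedModType R) (Y : set V)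
    (u : nat -> V) (l : V) :
  closed Y -> u @ \oo --> l -> (forall n, Y (u n)) -> Y l.
Proof.
by move=> cY ul uY; apply: (@closed_cvg _ _ _ _ u Y cY _ l ul); exact: nearW.
Qed.

Lemma half_pow_small (R : realType) (c eps : R) : 0 < eps ->
  exists N, forall n, (N <= n)%N -> c * 2^-1 ^+ n <= eps.
Proof.
move=> e0; have h : (c *: (2^-1 : R^o) ^+ n) @[n --> \oo] --> (0 : R^o).
  rewrite -(scaler0 _ c); apply: cvgZl_tmp.
  by apply: cvg_expr; rewrite ger0_norm ?invr_ge0// invf_lt1// ltr1n.
have [N hN] := (cvg_seqP _ _).1 h _ e0.
exists N => n /hN; rewrite sub0r normrN => /(le_trans (ler_norm _)); exact.
Qed.

Section Baire.
Variables (R : realType) (X : completeNormedModType R).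

(** Otherwise, for each [K], every ball centred in [Y] contains a closed ball centred in [Y] that
    misses [A K]. Nested balls of this kind with halving radii shrink to a point of [Y] outside
    every [A K]. *)
Lemma relative_Baire (Y : set X) (A : nat -> set X) :
  closed Y -> Y !=set0 -> (forall y, Y y -> exists K, A K y) ->
  exists K y0 r, [/\ Y y0, 0 < r & forall y, Y y -> `|y - y0| < r ->
    forall eps, 0 < eps -> exists2 z, A K z & `|y - z| < eps].
Proof.
move=> cY [y00 Yy00] YA; apply: contrapT => nob.
have step (K : nat) (yr : X * R) : exists yr' : X * R, Y yr.1 -> 0 < yr.2 ->
    [/\ Y yr'.1, 0 < yr'.2, yr'.2 <= yr.2 * 2^-1,
        `|yr'.1 - yr.1| + yr'.2 <= yr.2 &
        forall z, `|z - yr'.1| <= yr'.2 -> ~ A K z].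
  case: yr => y0 r /=.
  have [[Yy0 r0]|no] := pselect (Y y0 /\ 0 < r); last first.
    by exists (y0, r) => ? ?; case: no.
  have [y [Yy yr [eps e0 yA]]] : exists y, [/\ Y y, `|y - y0| < r &
      exists2 eps, 0 < eps & forall z, A K z -> eps <= `|y - z|].
    apply: contra_notP nob => no; exists K, y0, r; split => // y Yy yr eps e0.
    apply: contra_notP no => no; exists y; split=> //; exists eps => // z Az.
    by rewrite leNgt; apply/negP => yz; apply: no; exists z.
  (* The first bound makes the closed ball miss [A K], the second keeps it inside the previous ball,
     the third halves the radius. *)
  exists (y, Num.min (eps / 2) (Num.min (r - `|y - y0|) (r * 2^-1))) => /= _ _.
  split=> //.
  - by rewrite !lt_min divr_gt0// subr_gt0 yr mulr_gt0// invr_gt0.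
  - by rewrite !ge_min lexx !orbT.
  - by rewrite addrC -lerBrDr !ge_min lexx !orbT.
  - move=> z; rewrite !le_min => /andP[ze _] /yA; rewrite distrC leNgt => /negP; apply.
    by apply: le_lt_trans ze _; rewrite ltr_pdivrMr// ltr_pMr// ltr1n.
have /choice[F hF] : forall Kyr : nat * (X * R), exists yr' : X * R,
    Y Kyr.2.1 -> 0 < Kyr.2.2 ->
    [/\ Y yr'.1, 0 < yr'.2, yr'.2 <= Kyr.2.2 * 2^-1,
        `|yr'.1 - Kyr.2.1| + yr'.2 <= Kyr.2.2 &
        forall z, `|z - yr'.1| <= yr'.2 -> ~ A Kyr.1 z].
  by move=> [K yr]; exact: step.
pose fix s n : X * R := if n is n'.+1 then F (n', s n') else (y00, 1).
have sP n : Y (s n).1 /\ 0 < (s n).2.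
  elim: n => [//|n [Yn rn]] /=; have [Yn' rn' _ _ _] := hF (n, s n) Yn rn.
  by split.
have sS n : [/\ (s n.+1).2 <= (s n).2 * 2^-1,
    `|(s n.+1).1 - (s n).1| + (s n.+1).2 <= (s n).2 &
    forall z, `|z - (s n.+1).1| <= (s n.+1).2 -> ~ A n z].
  by have [Yn rn] := sP n; have [_ _] := hF (n, s n) Yn rn.
have nest n k : `|(s (n + k)%N).1 - (s n).1| + (s (n + k)%N).2 <= (s n).2.
  elim: k => [|k IH]; first by rewrite addn0 subrr normr0 add0r.
  have [_ h _] := sS (n + k)%N; rewrite addnS; apply: le_trans IH.
  apply: le_trans (lerD (lexx _) h); rewrite addrA lerD2r addrC.
  exact: ler_distD.
have nestd n m : (n <= m)%N -> `|(s n).1 - (s m).1| <= (s n).2.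
  move=> nm; have := nest n (m - n)%N; rewrite subnKC// distrC.
  by apply: le_trans; rewrite lerDl ltW//; exact: (sP m).2.
have rsmall n : (s n).2 <= 2^-1 ^+ n.
  elim: n => [|n IH]; first by rewrite expr0.
  have [h _ _] := sS n; apply: le_trans h _; rewrite exprSr.
  by apply: ler_wpM2r => //; rewrite ?invr_ge0.
have [y sy] : exists y : X, (fun n => (s n).1) @ \oo --> y.
  apply: cauchy_seq_cvg => eps e0; have [N hN] := half_pow_small 2 e0.
  exists N => m n Nm Nn; apply: le_trans (hN N (leqnn _)).
  have -> : (s m).1 - (s n).1 = - ((s N).1 - (s m).1) + ((s N).1 - (s n).1).
    by rewrite opprB addrA subrK.
  apply: le_trans (ler_normD _ _) _; rewrite normrN mulrDl mul1r.
  by apply: lerD; apply: le_trans (rsmall N); exact: nestd.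
have Yy : Y y by apply: cvg_closed_mem cY sy _ => n; exact: (sP n).1.
have [K AKy] := YA _ Yy; have [_ _ /(_ y)] := sS K; apply=> //.
rewrite distrC; apply: (cvg_norm_le (N := K.+1) sy) => n Kn; exact: nestd.
Qed.

End Baire.

(** * Basis constants *)

Section BasisConstant.
Variables (R : realType) (X : completeNormedModType R).
Implicit Types (x : nat -> X) (a b : nat -> R).

Definition partial_sum x a n := \sum_(i < n) a i *: x i.

Lemma series_partial_sum x a : series (fun i => a i *: x i) = partial_sum x a.
Proof. by apply/funext => n; rewrite /series /= big_mkord. Qed.

Lemma partial_sumD x a b n :
  partial_sum x (fun i => a i + b i) n = partial_sum x a n + partial_sum x b n.
Proof. by rewrite /partial_sum -big_split/=; apply: eq_bigr => i _; rewrite scalerDl. Qed.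

Lemma partial_sumZ x c a n :
  partial_sum x (fun i => c * a i) n = c *: partial_sum x a n.
Proof. by rewrite /partial_sum scaler_sumr; apply: eq_bigr => i _; rewrite scalerA. Qed.

Lemma partial_sumB x a b n :
  partial_sum x (fun i => a i - b i) n = partial_sum x a n - partial_sum x b n.
Proof. by rewrite /partial_sum -sumrB; apply: eq_bigr => i _; rewrite scalerBl. Qed.

Lemma partial_sumS x a n : partial_sum x a n.+1 = partial_sum x a n + a n *: x n.
Proof. by rewrite /partial_sum big_ord_recr. Qed.

Lemma coef_bound x a (C : R) : (forall n, `|partial_sum x a n| <= C) ->
  forall n, `|a n| * `|x n| <= 2 * C.
Proof.
move=> aC n; rewrite -normrZ.
have -> : a n *: x n = partial_sum x a n.+1 - partial_sum x a n.
  by rewrite partial_sumS addrAC subrr add0r.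
by rewrite mulrDl mul1r (le_trans (ler_normB _ _))// lerD.
Qed.

Lemma cvg_partial_sum x (a : nat -> nat -> R^o) (b : nat -> R^o) n :
  (forall i, a ^~ i @ \oo --> b i) ->
  (fun k => partial_sum x (a k) n) @ \oo --> partial_sum x b n.
Proof.
move=> ab; rewrite /partial_sum.
apply: cvg_big => [|i _]; first exact: add_continuous.
by apply: cvgZr_tmp; exact: ab.
Qed.

Variables (Y : set X) (x : nat -> X).
Hypothesis Y_closed : closed Y.
Hypothesis Y_linear : forall c u v, Y u -> Y v -> Y (c *: u + v).
Hypothesis xY : schauder_basis_of Y x.

Let expands a (y : X) := partial_sum x a @ \oo --> y.

Let expansion_ex y : Y y -> exists a, expands a y.
Proof. by move=> /xY.2[a [+ _]]; rewrite series_partial_sum; exists a. Qed.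

Let expansion_uniq a b y : Y y -> expands a y -> expands b y -> a = b.
Proof.
move=> /xY.2[c [_ cu]] ay by_.
by rewrite -(cu a) ?series_partial_sum// -(cu b) ?series_partial_sum.
Qed.

Let Y0 : Y 0.
Proof. by have := Y_linear (-1) (xY.1 0%N) (xY.1 0%N); rewrite scaleN1r addNr. Qed.

Let YZ c u : Y u -> Y (c *: u).
Proof. by move=> Yu; have := Y_linear c Yu Y0; rewrite addr0. Qed.

Let YB u v : Y u -> Y v -> Y (u - v).
Proof. by move=> Yu Yv; have := Y_linear (-1) Yv Yu; rewrite scaleN1r addrC. Qed.

Let expands0 : expands (fun=> 0) 0.
Proof.
rewrite /expands (_ : partial_sum x _ = fun=> 0); first exact: cvg_cst.
by apply/funext => n; rewrite /partial_sum big1// => i _; rewrite scale0r.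
Qed.

Lemma basis_neq0 i : x i != 0.
Proof.
apply/negP => /eqP xi0.
pose a (j : nat) : R := (j == i)%:R.
have : expands a 0.
  rewrite /expands (_ : partial_sum x _ = fun=> 0); first exact: cvg_cst.
  apply/funext => n; rewrite /partial_sum big1// => j _; rewrite /a.
  by have [->|_] := eqVneq (j : nat) i; rewrite ?xi0 ?scaler0// scale0r.
move=> /(expansion_uniq Y0)/(_ expands0)/(congr1 (@^~ i))/eqP.
by rewrite /a eqxx oner_eq0.
Qed.

Let expandsB a b y z : expands a y -> expands b z ->
  expands (fun i => a i - b i) (y - z).
Proof.
move=> ay bz; rewrite /expands (_ : partial_sum x _ = partial_sum x a \- partial_sum x b).
  exact: cvgB.
by apply/funext => n; rewrite partial_sumB.
Qed.

Let expandsZ c a y : expands a y -> expands (fun i => c * a i) (c *: y).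
Proof.
move=> ay; rewrite /expands (_ : partial_sum x _ = (fun n => c *: partial_sum x a n)).
  exact: cvgZl_tmp.
by apply/funext => n; rewrite partial_sumZ.
Qed.

Let approximable (M d : R) y (eps : R) := exists a z,
  [/\ Y z, expands a z, forall n, `|partial_sum x a n| <= M * d & `|y - z| <= eps].

(** Baire's theorem, for the sets of vectors whose partial sums are bounded by [K], makes one of
    them dense near some [y0]. A multiple of [y] is the difference of [y0 + t *: y] and [y0];
    approximating both carries the bound to all of [Y]. *)
Lemma approximate_expansion : exists2 M : R, 0 < M & forall y d eps,
  Y y -> 0 < d -> `|y| <= d -> 0 < eps -> approximable M d y eps.
Proof.
pose A (K : nat) := [set y | Y y /\
  exists2 a, expands a y & forall n, `|partial_sum x a n| <= K%:R].
have [|y Yy|K [y0 [r [Yy0 r0 hK]]]] := @relative_Baire R X Y A Y_closed.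
- by exists 0.
- have [a ay] := expansion_ex Yy.
  have /cvg_seq_bounded[M Mb] : cvgn (partial_sum x a) by apply/cvg_ex; exists y.
  have [K hK] : exists K : nat, forall n, `|partial_sum x a n| <= K%:R.
    exists (Num.bound `|M|) => n; apply: Mb.2 => //.
    by apply: le_lt_trans (ler_norm _) _; rewrite archi_boundP.
  by exists K; split=> //; exists a.
exists (4 * K.+1%:R / r) => [|y d eps Yy d0 yd e0].
  by rewrite divr_gt0// mulr_gt0// ltr0Sn.
(* With this factor [y0 + t *: y] lies within [r / 2] of [y0]. *)
pose t := r / (2 * d); have t0 : 0 < t by rewrite divr_gt0// mulr_gt0.
have [|||z1 [Yz1 [a1 a1z1 a1K]] yz1] := hK (y0 + t *: y) _ _ (eps * t / 2).
- by rewrite addrC; exact: Y_linear.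
- rewrite addrAC subrr add0r normrZ gtr0_norm//.
  apply: le_lt_trans (ler_wpM2l (ltW t0) yd) _.
  rewrite /t invfM mulrA mulfVK ?gt_eqF//.
  by rewrite ltr_pdivrMr// ltr_pMr// ltr1n.
- by rewrite divr_gt0// mulr_gt0.
have [||z2 [Yz2 [a2 a2z2 a2K]] yz2] := hK y0 Yy0 _ (eps * t / 2).
- by rewrite subrr normr0.
- by rewrite divr_gt0// mulr_gt0.
exists (fun i => t^-1 * (a1 i - a2 i)), (t^-1 *: (z1 - z2)); split.
- by apply: YZ; exact: YB.
- by apply: expandsZ; exact: expandsB.
- move=> n; rewrite partial_sumZ partial_sumB normrZ gtr0_norm ?invr_gt0//.
  have -> : 4 * K.+1%:R / r * d = t^-1 * (K.+1%:R + K.+1%:R).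
    by rewrite /t invf_div; field; rewrite gt_eqF.
  rewrite ler_pM2l ?invr_gt0//; apply: le_trans (ler_normB _ _) _.
  by apply: lerD; apply: le_trans (_ : K%:R <= _) => //; rewrite ler_nat.
- have -> : y - t^-1 *: (z1 - z2) = t^-1 *: ((y0 + t *: y - z1) - (y0 - z2)).
    rewrite -(addrA y0) [- (y0 - z2)]opprD opprK addrACA subrr add0r.
    rewrite -addrA (_ : - z1 + z2 = - (z1 - z2)); last by rewrite opprB addrC.
    by rewrite [RHS]scalerBr scalerA mulVf ?gt_eqF// scale1r.
  rewrite normrZ gtr0_norm ?invr_gt0// ler_pdivrMl//.
  apply: le_trans (ler_normB _ _) _; rewrite [t * _]mulrC [leRHS]splitr.
  by apply: lerD; exact: ltW.
Qed.

(* Successive approximation of the remainders. *)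
Lemma basis_constant_unit : exists2 K : R, 0 < K & forall y a,
  Y y -> `|y| <= 1 -> expands a y -> forall n, `|partial_sum x a n| <= K.
Proof.
have [M M0 hM] := approximate_expansion.
pose h j : R := 2^-1 ^+ j.
have h0 j : 0 < h j by rewrite exprn_gt0// invr_gt0.
have hS j : h j = h j.+1 + h j.+1 by rewrite /h exprS; lra.
have /choice[F hF] : forall jy : nat * X, exists ay' : (nat -> R) * X,
    Y jy.2 -> `|jy.2| <= h jy.1 ->
    [/\ Y ay'.2, `|ay'.2| <= h jy.1.+1, expands ay'.1 (jy.2 - ay'.2) &
        forall n, `|partial_sum x ay'.1 n| <= M * h jy.1].
  move=> [j y] /=; have [[Yy yh]|no] := pselect (Y y /\ `|y| <= h j); last first.
    by exists (fun=> 0, y) => ? ?; case: no.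
  have [a [z [Yz az aM yz]]] := hM y (h j) (h j.+1) Yy (h0 _) yh (h0 _).
  exists (a, y - z) => _ _ /=; split=> //; first exact: YB.
  by rewrite opprB addrCA subrr addr0.
exists (M * 2) => [|y b Yy y1 by_]; first by rewrite mulr_gt0.
pose fix r j := if j is j'.+1 then (F (j', r j')).2 else y.
pose a j := (F (j, r j)).1.
have rP j : Y (r j) /\ `|r j| <= h j.
  elim: j => [|j [Yr rh]]; first by rewrite /h expr0.
  by have [] := hF (j, r j) Yr rh.
have aP j : expands (a j) (r j - r j.+1) /\
    forall n, `|partial_sum x (a j) n| <= M * h j.
  by have [Yr rh] := rP j; have [_ _] := hF (j, r j) Yr rh.
pose c J i := \sum_(j < J) a j i.
have cS J n : partial_sum x (c J.+1) n = partial_sum x (c J) n + partial_sum x (a J) n.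
  by rewrite -partial_sumD; congr partial_sum; apply/funext => i; rewrite /c big_ord_recr.
have c0 n : partial_sum x (c 0%N) n = 0.
  by rewrite /partial_sum big1// => i _; rewrite /c big_ord0 scale0r.
have c_exp J : expands (c J) (y - r J).
  elim: J => [|J IH].
    rewrite subrr /expands (_ : partial_sum x _ = fun=> 0); first exact: cvg_cst.
    by apply/funext => n; rewrite c0.
  have -> : y - r J.+1 = (y - r J) + (r J - r J.+1) by rewrite addrA subrK.
  rewrite /expands (_ : partial_sum x _ = partial_sum x (c J) \+ partial_sum x (a J)).
    by apply: cvgD => //; exact: (aP J).1.
  by apply/funext => n; rewrite cS.
(* The terms [h j] with [J <= j < J + k] sum to [2 * (h J - h (J + k))]. *)
have c_tail n J k : `|partial_sum x (c (J + k)%N) n - partial_sum x (c J) n| <=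
    M * (2 * (h J - h (J + k)%N)).
  elim: k => [|k IH]; first by rewrite addn0 !subrr normr0 !mulr0.
  rewrite addnS cS addrAC; apply: le_trans (ler_normD _ _) _.
  apply: le_trans (lerD IH ((aP _).2 n)) _; rewrite -mulrDr ler_pM2l//.
  by rewrite (hS (J + k)%N) ; lra.
have c_cauchy n J L : (J <= L)%N ->
    `|partial_sum x (c L) n - partial_sum x (c J) n| <= M * 2 * h J.
  move=> JL; have := c_tail n J (L - J)%N; rewrite subnKC// => /le_trans; apply.
  by rewrite -mulrA ler_pM2l//; have := h0 L; lra.
(* As no [x i] vanishes, bounds on partial sums bound single coefficients, so each coefficient
   sequence is Cauchy. *)
have /choice[d hd] : forall i, exists di : R^o, c ^~ i @ \oo --> di.
  move=> i; have x0 : 0 < `|x i| by rewrite normr_gt0 basis_neq0.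
  apply: cauchy_seq_cvg => eps e0.
  have [N hN] := half_pow_small (2 * (2 * (M * 2)) / `|x i|) e0.
  exists N => m n Nm Nn; apply: le_trans (hN N (leqnn _)).
  have cN k : (N <= k)%N -> `|c k i - c N i| <= 2 * (M * 2 * h N) / `|x i|.
    move=> Nk; rewrite ler_pdivlMr//.
    apply: (coef_bound (x := x) (a := fun i => c k i - c N i)) => l.
    by rewrite partial_sumB; exact: c_cauchy.
  have -> : c m i - c n i = (c m i - c N i) - (c n i - c N i).
    by rewrite opprB addrA subrK.
  apply: le_trans (ler_normB _ _) _; apply: le_trans (lerD (cN _ Nm) (cN _ Nn)) _.
  rewrite le_eqVlt; apply/orP; left; apply/eqP; rewrite -/(h N); set hN' := h N.
  by field; rewrite gt_eqF.
have d_tail n J : `|partial_sum x d n - partial_sum x (c J) n| <= M * 2 * h J.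
  rewrite distrC; have hn := cvg_partial_sum (x := x) (n := n) hd.
  apply: (cvg_norm_le (N := J) hn) => L JL.
  by rewrite distrC; exact: c_cauchy.
have d_exp : expands d y.
  apply/cvg_seqP => eps e0.
  have [J /(_ J (leqnn _)) hJ] := half_pow_small (M * 2 + 1) (divr_gt0 e0 (ltr0n _ 2)).
  have [N hN] := (cvg_seqP _ _).1 (c_exp J) _ (divr_gt0 e0 (ltr0n _ 2)).
  exists N => n Nn; have {hN} := hN n Nn.
  have -> : y - partial_sum x d n = (y - r J - partial_sum x (c J) n) + r J
      - (partial_sum x d n - partial_sum x (c J) n).
    by rewrite opprB [in RHS]addrAC addrA subrK addrAC subrK.
  move=> hN; apply: le_trans (ler_normB _ _) _; rewrite [eps]splitr.
  apply: le_trans (lerD (ler_normD _ _) (d_tail n J)) _.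
  rewrite -addrA; apply: lerD => //; apply: le_trans hJ.
  by rewrite mulrDl mul1r addrC lerD2l; exact: (rP J).2.
(* Uniqueness identifies the given expansion [b] with the constructed [d]; the tail estimate at
   [J = 0] then yields the constant [M * 2]. *)
move=> n; rewrite (expansion_uniq Yy by_ d_exp).
by have := d_tail n 0%N; rewrite c0 subr0 /h expr0 mulr1.
Qed.

Theorem basis_constant : exists2 K : R, 0 < K & forall y a,
  Y y -> partial_sum x a @ \oo --> y -> forall n, `|partial_sum x a n| <= K * `|y|.
Proof.
have [K K0 hK] := basis_constant_unit; exists K => // y a Yy ay n.
have [y0|y0] := eqVneq y 0.
  move: ay Yy; rewrite y0 => ay Y0'; rewrite (expansion_uniq Y0 ay expands0).
  by rewrite normr0 mulr0 /partial_sum big1 ?normr0// => i _; rewrite scale0r.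
have yp : 0 < `|y| by rewrite normr_gt0.
have := hK (`|y|^-1 *: y) _ (YZ _ Yy) _ (expandsZ (c := `|y|^-1) ay) n.
rewrite partial_sumZ !normrZ gtr0_norm ?invr_gt0// mulVf ?gt_eqF//.
by rewrite ler_pdivrMl// mulrC; apply.
Qed.

End BasisConstant.

(** * Grunblum's criterion for basic sequences *)

Section BasicSequence.
Variables (R : realType) (X : completeNormedModType R).
Implicit Types (x : nat -> X) (a b : nat -> R) (p q : {poly R}).

(** Only finite sums are compared, so the condition passes to coordinatewise limits of [x]. *)
Definition has_basis_constant x (K : R) := forall a m n, (m <= n)%N ->
  `|partial_sum x a m| <= K * `|partial_sum x a n|.

Lemma partial_sum_trunc x a N m :
  partial_sum x (fun i => if (i < N)%N then a i else 0) m =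
  partial_sum x a (minn m N).
Proof.
elim: m => [|m IH]; first by rewrite min0n /partial_sum !big_ord0.
rewrite partial_sumS IH; have [mN|Nm] := ltnP m N.
  by rewrite (minn_idPl mN) partial_sumS.
by rewrite scale0r addr0 (minn_idPr (leqW Nm)).
Qed.

Lemma partial_sum_eq x a b n : (forall i, (i < n)%N -> a i = b i) ->
  partial_sum x a n = partial_sum x b n.
Proof. by move=> ab; apply: eq_bigr => i _; rewrite ab. Qed.

Lemma lin_comb_partial_sum x p n : (size p <= n)%N ->
  lin_comb x p = partial_sum x (fun i => p`_i) n.
Proof.
move=> pn; rewrite -[LHS]/(partial_sum x (fun i => p`_i) (size p)).
rewrite -[in LHS](minn_idPr pn) -partial_sum_trunc; apply: partial_sum_eq => i _.
by case: ltnP => // ip; rewrite nth_default.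
Qed.

Lemma lin_comb_poly x a n : lin_comb x (\poly_(i < n) a i) = partial_sum x a n.
Proof.
rewrite (lin_comb_partial_sum _ (size_poly n a)); apply: partial_sum_eq => i ilt.
by rewrite coef_poly ilt.
Qed.

Lemma lin_combP x c p q :
  lin_comb x (c *: p + q) = c *: lin_comb x p + lin_comb x q.
Proof.
pose n := maxn (size (c *: p + q)) (maxn (size p) (size q)).
rewrite !(@lin_comb_partial_sum _ _ n) ?leq_max ?leqnn ?orbT//.
rewrite -partial_sumZ -partial_sumD; apply: partial_sum_eq => i _.
by rewrite coefD coefZ.
Qed.

Let Y x := closure (range (lin_comb x)).

Lemma closure_lin_combP x y : Y x y <->
  forall eps, 0 < eps -> exists p, `|y - lin_comb x p| <= eps.
Proof.
split=> [Yy eps e0|h B /nbhs_ballP[eps e0 yB]].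
  have [_ [[p _ <-]]] := Yy _ (nbhsx_ballx y _ e0).
  by rewrite -ball_normE /= => /ltW; exists p.
have [p hp] := h (eps / 2) (divr_gt0 e0 (ltr0n _ 2)).
exists (lin_comb x p); split; first by exists p.
apply: yB; rewrite -ball_normE /=; apply: le_lt_trans hp _.
by rewrite ltr_pdivrMr// ltr_pMr// ltr1n.
Qed.

Lemma closure_lin_comb_linear x c u v : Y x u -> Y x v -> Y x (c *: u + v).
Proof.
move=> /closure_lin_combP Yu /closure_lin_combP Yv; apply/closure_lin_combP => eps e0.
have c0 : 0 < `|c| + 1 by rewrite ltr_wpDl.
have [p hp] := Yu (eps / 2 / (`|c| + 1)) (divr_gt0 (divr_gt0 e0 (ltr0n _ 2)) c0).
have [q hq] := Yv (eps / 2) (divr_gt0 e0 (ltr0n _ 2)).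
exists (c *: p + q); rewrite lin_combP opprD addrACA -scalerBr.
apply: le_trans (ler_normD _ _) _; rewrite [eps]splitr; apply: lerD => //.
rewrite normrZ; apply: le_trans (_ : (`|c| + 1) * (eps / 2 / (`|c| + 1)) <= _).
  by apply: ler_pM => //; rewrite lerDl.
by rewrite mulrC divfK ?gt_eqF.
Qed.

Lemma lin_comb_closure x p : Y x (lin_comb x p).
Proof. by apply: subset_closure; exists p. Qed.

Lemma basic_sequence_constant x : basic_sequence x ->
  exists2 K, 0 < K & has_basis_constant x K.
Proof.
move=> bx; have [K K0 hK] :=
  basis_constant (@closed_closure _ _) (@closure_lin_comb_linear x) bx.
exists K => // a m n mn.
rewrite -[X in partial_sum x a X](minn_idPl mn) -partial_sum_trunc.
apply: hK; first by rewrite -lin_comb_poly; exact: lin_comb_closure.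
apply/cvg_seqP => eps e0; exists n => k nk.
by rewrite partial_sum_trunc (minn_idPr nk) subrr normr0 ltW.
Qed.

(** If [lin_comb x (p k)] tends to [y], then by [K] the partial sums of the [p k] are Cauchy
    uniformly in their length, and by [c] so are the coefficients; their limits expand [y]. For
    uniqueness, [K] forces all partial sums of an expansion of zero to vanish. *)
Lemma basic_of_constant x (c K : R) : 0 < c -> 0 < K ->
  (forall i, c <= `|x i|) -> has_basis_constant x K -> basic_sequence x.
Proof.
move=> c0 K0 cx xK.
have inj a : partial_sum x a @ \oo --> (0 : X) -> a = fun=> 0.
  move=> a0; have S0 n : partial_sum x a n = 0.
    apply/normr0_eq0/eqP; rewrite eq_le normr_ge0 andbT.
    apply/ler_addgt0Pr => eps e0; rewrite add0r.
    have [N hN] := (cvg_seqP _ _).1 a0 _ (divr_gt0 e0 K0).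
    have := hN (maxn n N) (leq_maxr _ _); rewrite sub0r normrN => h.
    apply: le_trans (xK a n (maxn n N) (leq_maxl _ _)) _.
    by rewrite mulrC -ler_pdivlMr.
  apply/funext => i; have := S0 i.+1; rewrite partial_sumS S0 add0r => /eqP.
  rewrite scaler_eq0 => /orP[/eqP//|/eqP xi0].
  by have := cx i; rewrite xi0 normr0 leNgt c0.
split=> [i|y /closure_lin_combP Yy].
  suff -> : x i = lin_comb x 'X^i by exact: lin_comb_closure.
  rewrite (@lin_comb_partial_sum _ _ i.+1) ?size_polyXn// partial_sumS coefXn eqxx.
  rewrite scale1r (_ : partial_sum _ _ _ = 0) ?add0r// /partial_sum big1// => j _.
  by rewrite coefXn ltn_eqF// scale0r.
have h0 k : 0 < 2^-1 ^+ k :> R by rewrite exprn_gt0// invr_gt0.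
have /choice[p hp] : forall k : nat, exists p, `|y - lin_comb x p| <= 2^-1 ^+ k.
  by move=> k; exact: Yy.
pose s k n := partial_sum x (fun i => (p k)`_i) n.
have s_diff n j k N : (N <= j)%N -> (N <= k)%N ->
    `|s j n - s k n| <= K * 2 * 2^-1 ^+ N.
  move=> Nj Nk; pose m := maxn n (maxn (size (p j)) (size (p k))).
  rewrite /s -partial_sumB; apply: le_trans (xK _ _ m (leq_maxl _ _)) _.
  rewrite -mulrA ler_pM2l// partial_sumB -!lin_comb_partial_sum ?leq_max ?leqnn ?orbT//.
  have -> : lin_comb x (p j) - lin_comb x (p k) =
      (y - lin_comb x (p k)) - (y - lin_comb x (p j)).
    by rewrite opprB [RHS]addrC addrA subrK.
  have hN l : (N <= l)%N -> `|y - lin_comb x (p l)| <= 2^-1 ^+ N.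
    move=> Nl; apply: le_trans (hp l) _; apply: ler_wiXn2l => //.
    by rewrite invf_le1// ler1n.
  apply: le_trans (ler_normB _ _) _; rewrite mulrDl mul1r.
  by apply: lerD; exact: hN.
have /choice[a ha] : forall i, exists ai : R^o, (fun k => (p k)`_i) @ \oo --> ai.
  move=> i; apply: cauchy_seq_cvg => eps e0.
  have [N hN] := half_pow_small (2 * (K * 2) / c) e0.
  exists N => j k Nj Nk; apply: le_trans (hN N (leqnn _)).
  rewrite mulrAC ler_pdivlMr//.
  apply: (@le_trans _ _ (`|(p j)`_i - (p k)`_i| * `|x i|)); first exact: ler_wpM2l.
  rewrite -mulrA; apply: (coef_bound (x := x) (a := fun i => (p j)`_i - (p k)`_i)) => n.
  by rewrite partial_sumB; exact: s_diff.
have sa n k : `|s k n - partial_sum x a n| <= K * 2 * 2^-1 ^+ k.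
  have hn := cvg_partial_sum (x := x) (n := n) ha.
  by apply: (cvg_norm_le (N := k) hn) => j kj; exact: s_diff.
have ay : partial_sum x a @ \oo --> y.
  apply/cvg_seqP => eps e0; have [k /(_ k (leqnn _)) hk] := half_pow_small (1 + K * 2) e0.
  exists (size (p k)) => n kn.
  have -> : y - partial_sum x a n = (y - s k n) + (s k n - partial_sum x a n).
    by rewrite addrA subrK.
  apply: le_trans hk; apply: le_trans (ler_normD _ _) _; rewrite mulrDl mul1r.
  by apply: lerD => //; rewrite /s -lin_comb_partial_sum.
exists a; split; first by rewrite series_partial_sum.
move=> b; rewrite series_partial_sum => yb.
have : (fun i => a i - b i) = fun=> 0.
  apply: inj; rewrite -(subrr y).
  rewrite (_ : partial_sum x _ = partial_sum x a \- partial_sum x b).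
    exact: cvgB.
  by apply/funext => n; rewrite partial_sumB.
move=> ab; apply/funext => i; apply/eqP; rewrite -subr_eq0; apply/eqP.
exact: (congr1 (@^~ i) ab).
Qed.

End BasicSequence.

(** * Coding in a separable complete space *)

Lemma countable_enum (T : Type) (D : set T) (t0 : T) : countable D ->
  exists d : nat -> T, forall t, D t -> exists n, d n = t.
Proof.
move=> /countable_injP[f finj].
have /choice[d hd] : forall n, exists t, (exists2 u, D u & f u = n) -> D t /\ f t = n.
  move=> n; have [[u Du fu]|no] := pselect (exists2 u, D u & f u = n).
    by exists u.
  by exists t0 => yes.
exists d => t Dt; exists (f t); have [Dd fd] := hd (f t) (ex_intro2 _ _ t Dt erefl).
by apply: finj => //; rewrite inE.
Qed.

Section Coding.
Variables (R : realType) (X : completeNormedModType R) (I : countType) (T : Type).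
Variables (P : (nat -> X) -> (I -> nat) -> T -> Prop) (E : nat -> T -> T -> Prop).

(** Convergence in the product topology, the naturals being discrete. *)
Definition cvg_param (x_ : nat -> nat -> X) (w_ : nat -> I -> nat)
    (x : nat -> X) (w : I -> nat) :=
  (forall i, x_ ^~ i @ \oo --> x i) /\
  (forall i, exists N, forall k, (N <= k)%N -> w_ k i = w i).

Let S := [set t | exists x w, P x w t].
Let equiv t u := exists n, E n t u.

Hypothesis X_separable : separable X.
Hypothesis P_closed : forall x_ w_ t_ x w, cvg_param x_ w_ x w ->
  (forall k, P (x_ k) (w_ k) (t_ k)) -> exists t, P x w t.
Hypothesis E_closed : forall n x_ w_ t_ x w t y_ v_ u_ y v u,
  cvg_param x_ w_ x w -> (forall k, P (x_ k) (w_ k) (t_ k)) -> P x w t ->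
  cvg_param y_ v_ y v -> (forall k, P (y_ k) (v_ k) (u_ k)) -> P y v u ->
  (forall k, E n (t_ k) (u_ k)) -> E n t u.
Hypothesis E_mono : forall m n t u, S t -> S u -> (m <= n)%N -> E m t u -> E n t u.
Hypothesis E_sym : forall n t u, E n t u -> E n u t.
Hypothesis E_trans : forall t u v, S t -> S u -> S v ->
  equiv t u -> equiv u v -> equiv t v.

(* Position [inl (i, m)] of a code holds the index, in a dense sequence [d], of a
   [2^-m]-approximation of [x i]; position [inr i] holds [w i]. *)
Let pos (j : nat * nat + I) : nat := pickle j.

Let approximates (d : nat -> X) (a : nat -> nat) (x : nat -> X) :=
  forall i m, `|x i - d (a (pos (inl (i, m))))| <= 2^-1 ^+ m.

Let codes (d : nat -> X) (a : nat -> nat) (t : T) := exists x,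
  approximates d a x /\ P x (fun i => a (pos (inr i))) t.

Let pow_small (eps : R) : 0 < eps -> exists l, 2^-1 ^+ l + 2^-1 ^+ l <= eps.
Proof.
move=> e0; have [l /(_ l (leqnn _))] := half_pow_small 2 e0.
by rewrite mulrDl mul1r; exists l.
Qed.

Let approximates_dist d a b x y i l : approximates d a x -> approximates d b y ->
  a (pos (inl (i, l))) = b (pos (inl (i, l))) ->
  `|x i - y i| <= 2^-1 ^+ l + 2^-1 ^+ l.
Proof.
move=> ax byy ab; have -> : x i - y i =
    (x i - d (a (pos (inl (i, l))))) - (y i - d (b (pos (inl (i, l))))).
  by rewrite ab opprB addrA subrK.
by apply: le_trans (ler_normB _ _) (lerD (ax _ _) (byy _ _)).
Qed.

Let agree_cvg d a b_ x_ x : (forall m, agree m (b_ m) a) ->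
  (forall m, approximates d (b_ m) (x_ m)) -> approximates d a x ->
  cvg_param x_ (fun m i => b_ m (pos (inr i))) x (fun i => a (pos (inr i))).
Proof.
move=> ba bx ax; split=> i; last first.
  by exists (pos (inr i)).+1 => k ik; exact: ba.
apply/cvg_seqP => eps /pow_small[l hl].
exists (pos (inl (i, l))).+1 => n nl; apply: le_trans hl.
by apply: (approximates_dist ax (bx n)); rewrite ba.
Qed.

(** Codes that share the entry at [pos (inl (i, l))] name the same approximation, which puts their
    [i]-th vectors within [2 * 2^-l] of each other. Convergent codes thus have coordinatewise Cauchy
    sequences. *)
Let agree_limit d a b_ x_ : (forall m, agree m (b_ m) a) ->
  (forall m, approximates d (b_ m) (x_ m)) -> exists x, approximates d a x.
Proof.
move=> ba bx; have /choice[x hx] : forall i, exists xi : X, x_ ^~ i @ \oo --> xi.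
  move=> i; apply: cauchy_seq_cvg => eps /pow_small[l hl].
  exists (pos (inl (i, l))).+1 => m n lm ln; apply: le_trans hl.
  by apply: (approximates_dist (bx m) (bx n)); rewrite !ba.
exists x => i m; rewrite distrC.
apply: (cvg_norm_le (N := (pos (inl (i, m))).+1) (hx i)) => n ln.
by rewrite distrC -(ba n) //; exact: bx.
Qed.

Lemma codes_ex : exists d, forall t, S t <-> exists a, codes d a t.
Proof.
have [D [cD dD]] := X_separable; have [d dP] := countable_enum 0 cD.
exists d => t; split=> [[x [w Pxw]]|[a [x [_ Pxw]]]]; last first.
  by exists x, (fun i => a (pos (inr i))).
have /choice[f hf] : forall im : nat * nat, exists n, `|x im.1 - d n| <= 2^-1 ^+ im.2.
  move=> [i m] /=; have e0 : 0 < 2^-1 ^+ m :> R by rewrite exprn_gt0// invr_gt0.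
  have [||y [yb Dy]] := dD (ball (x i) (2^-1 ^+ m)).
  - by exists (x i); exact: ballxx.
  - exact: ball_open.
  - have [n dn] := dP _ Dy; exists n; move: yb; rewrite -ball_normE /= dn.
    exact: ltW.
pose a n := if unpickle n is Some j then
  match j with inl im => f im | inr i => w i end else 0%N.
exists a, x; split => [i m|].
  by rewrite /a pickleK; exact: (hf (i, m)).
rewrite (_ : (fun i => _) = w)//; apply/funext => i.
by rewrite /a pickleK.
Qed.

(** Convergence of codes in the Baire space implies [cvg_param] for what they code, so closedness of
    [P] and [E] pulls back to the hypotheses of [closed_graded_dichotomy]. *)
Theorem coded_dichotomy :
  (exists phi : (nat -> bool) -> T,
    (forall x, S (phi x)) /\
    (forall x y, x <> y -> ~ equiv (phi x) (phi y))) \/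
  (forall F, F `<=` S ->
    (forall t u, F t -> F u -> t <> u -> ~ equiv t u) -> countable F).
Proof.
have [d SE] := codes_ex.
have -> : S = [set t | exists a, codes d a t] by apply/seteqP; split=> t /SE.
apply: closed_graded_dichotomy.
- move=> a ha.
  have /choice[b_ hb] : forall m, exists b, agree m b a /\ exists t, codes d b t.
    by move=> m; have [b [t [ba bt]]] := ha m; exists b; split=> //; exists t.
  have /choice[t_ ht] : forall m, exists t, codes d (b_ m) t.
    by move=> m; exact: (hb m).2.
  have /choice[x_ hx] := ht.
  have ba m : agree m (b_ m) a by exact: (hb m).1.
  have bx m : approximates d (b_ m) (x_ m) by exact: (hx m).1.
  have [x ax] := agree_limit ba bx.
  have [t Pt] := P_closed (agree_cvg ba bx ax) (fun m => (hx m).2).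
  by exists t, x.
- move=> n a b t u [x [ax Pt]] [y [byy Pu]] h.
  have /choice[a_ ha] := h; have {ha}/choice[b_ hb] := ha.
  have {hb}/choice[t_ ht] := hb; have {ht}/choice[u_ hu] := ht.
  have /choice[x_ hx] : forall m, exists x, approximates d (a_ m) x /\
      P x (fun i => a_ m (pos (inr i))) (t_ m) by move=> m; have [] := hu m.
  have /choice[y_ hy] : forall m, exists y, approximates d (b_ m) y /\
      P y (fun i => b_ m (pos (inr i))) (u_ m) by move=> m; have [] := hu m.
  have aa m : agree m (a_ m) a by have [] := hu m.
  have bb m : agree m (b_ m) b by have [] := hu m.
  apply: (E_closed (agree_cvg aa (fun m => (hx m).1) ax) (fun m => (hx m).2) Pt
    (agree_cvg bb (fun m => (hy m).1) byy) (fun m => (hy m).2) Pu) => m.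
  by have [] := hu m.
- by move=> m n t u /SE St /SE Su; exact: E_mono.
- exact: E_sym.
- by move=> t u v /SE St /SE Su /SE Sv; exact: E_trans.
Qed.

End Coding.

(** * Cardinality of the continuum *)

Lemma reals_uncountable (R : realType) : ~ countable [set: R].
Proof.
move=> /countable_lebesgue_measure0 RT0.
have : (lebesgue_measure `[0%R, 1%R : R]%classic <= lebesgue_measure [set: R])%E.
  by apply: le_measure => //; rewrite inE.
by rewrite lebesgue_measure_itv /= lte_fin ltr01 RT0 oppr0 adde0 lee_fin ler10.
Qed.

Lemma injective_card_le (T U : Type) (f : T -> U) : injective f ->
  ([set: T] #<= [set: U])%card.
Proof.
move=> finj.
have /inj_card_eq : {in [set: T] &, injective f} by move=> x y _ _; exact: finj.
rewrite card_eq_le => /andP[_ le]; apply: card_le_trans le _.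
exact: subset_card_le.
Qed.

Lemma separable_reals (R : realType) : separable (R^o : topologicalType).
Proof.
exists (range (@ratr R)); split; last exact: dense_rat.
by apply: sub_countable (card_image_le _ _) _; exact: countableP.
Qed.

(* An uncountable perfect set of reals comes from the dichotomy for equality. *)
Lemma card_cantor_reals (R : realType) : ([set: nat -> bool] #= [set: R])%card.
Proof.
rewrite card_eq_le; apply/andP; split; last first.
  (* A real is determined by the set of rationals below it. *)
  apply: (@injective_card_le _ _ (fun (r : R) n =>
    if unpickle n is Some q then ratr q < r else false)) => x y xy.
  have lt (u v : R) : u < v -> exists2 q : rat, (ratr q < u) = false & ratr q < v.
    move=> uv; have [q] := rat_in_itvoo uv; rewrite in_itv /= => /andP[uq qv].
    by exists q => //; apply/negbTE; rewrite -leNgt ltW.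
  have [/lt[q qx qy]|/lt[q qx qy]|//] := ltgtP x y;
  by have := congr1 (@^~ (pickle q)) xy; rewrite pickleK qx qy.
pose P (x : nat -> R^o) (w : unit -> nat) (t : R) := x 0%N = t.
have := @coded_dichotomy R R^o unit R P (fun _ t u => t = u) (separable_reals R).
case=> [|||||[phi [_ hphi]]|h].
- by move=> x_ w_ t_ x w _ _; exists (x 0%N).
- move=> n x_ w_ t_ x w t y_ v_ u_ y v u [xx _] xt <- [yy _] yu <- tu.
  have e : x_ ^~ 0%N = y_ ^~ 0%N by apply/funext => k; rewrite (xt k) (yu k) tu.
  have xy0 : x_ ^~ 0%N @ \oo --> y 0%N by rewrite e; exact: yy.
  exact: (cvg_unique _ (xx 0%N) xy0).
- by [].
- by [].
- by move=> t u v _ _ _ [_ ->] [_ ->]; exists 0%N.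
- apply: (@injective_card_le _ _ phi) => x y xy.
  by apply: contrapT => /hphi; apply; exists 0%N.
- exfalso; apply: (@reals_uncountable R); apply: h.
    by move=> t _; exists (fun=> t), (fun=> 0%N).
  by move=> t u _ _ tu [_].
Qed.

(** * Codes of spreading models *)

Section SpreadingCodes.
Variables (R : realType) (X : completeNormedModType R).
Implicit Types (x : nat -> X) (p : {poly R}) (rho : {poly R} -> R).

Definition combo x k (r : 'I_k.+1 -> R) (l : 'I_k.+1 -> nat) :=
  \sum_(i < k.+1) r i *: x (l i).

Definition increasing k (l : 'I_k.+1 -> nat) :=
  forall i j : 'I_k.+1, (i < j)%N -> (l i < l j)%N.

(** The number [q] is both the bound on the coefficients and the accuracy. Uniformity over the
    coefficients leaves countably many witnesses, one natural number for each [(k, q)]. *)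
Definition uniform_modulus x (w : nat * nat -> nat) :=
  forall k q (r : 'I_k.+1 -> R) l l', (forall i, `|r i| <= q%:R) ->
    increasing l -> increasing l' ->
    (w (k, q) <= l ord0)%N -> (w (k, q) <= l' ord0)%N ->
    `| `|combo x r l| - `|combo x r l'| | <= q.+1%:R^-1.

(** The single [K] bounds the norms from both sides and gives the basis constant. All three
    conditions are non-strict inequalities on finite combinations, so they survive coordinatewise
    limits. *)
Definition admissible x K w :=
  [/\ forall i, K.+1%:R^-1 <= `|x i| <= K.+1%:R,
      has_basis_constant x K.+1%:R & uniform_modulus x w].

Lemma spreading_limitP k (r : 'I_k.+1 -> R) x (L : R) :
  `|\sum_(i < k.+1) r i *: x (l i)| @[l --> increasing_tuples k] --> L <->
  forall eps, 0 < eps -> exists N, forall l, increasing l -> (N <= l ord0)%N ->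
    `|L - `|combo x r l| | <= eps.
Proof.
split=> [/cvgrPdist_le h eps e0|h].
  by have [N _ hN] := h _ e0; exists N => l li Nl; apply: hN; split.
apply/cvgrPdist_le => eps e0; have [N hN] := h _ e0.
by exists N => // l [Nl li]; exact: hN.
Qed.

Lemma combo_dist x (C d : R) k (r s : 'I_k.+1 -> R) l :
  (forall i, `|x i| <= C) -> (forall i, `|r i - s i| <= d) ->
  `| `|combo x r l| - `|combo x s l| | <= k.+1%:R * (d * C).
Proof.
move=> xC rs; apply: le_trans (ler_dist_dist _ _) _.
rewrite /combo -sumrB; apply: le_trans (ler_norm_sum _ _ _) _.
rewrite mulr_natl -[X in _ *+ X]card_ord -sumr_const; apply: ler_sum => i _.
by rewrite -scalerBl normrZ; apply: ler_pM.
Qed.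

Lemma grid_approx (q M : nat) (t : R) : (0 < M)%N -> `|t| <= q%:R ->
  exists j : 'I_(2 * q * M).+1, `|t - (j%:R / M%:R - q%:R)| <= M%:R^-1.
Proof.
move=> M0; rewrite ler_norml => /andP[t1 t2].
have MR : 0 < M%:R :> R by rewrite ltr0n.
pose v := (t + q%:R) * M%:R.
have v0 : 0 <= v by rewrite mulr_ge0// -lerBlDr sub0r.
have /andP[jv vj] := truncn_itv v0.
have jlt : (Num.truncn v < (2 * q * M).+1)%N.
  rewrite ltnS -(ler_nat R); apply: le_trans jv _.
  by rewrite /v !natrM ler_pM2r//; lra.
exists (Ordinal jlt) => /=.
have -> : t - ((Num.truncn v)%:R / M%:R - q%:R) = (v - (Num.truncn v)%:R) / M%:R.
  by rewrite /v; field; rewrite gt_eqF.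
rewrite ger0_norm; last by rewrite divr_ge0 ?(ltW MR)// subr_ge0.
by rewrite -[leRHS]mul1r ler_pM2r ?invr_gt0// lerBlDr addrC natr1 ltW.
Qed.

(* Total boundedness of the coefficient cube makes the convergence uniform. *)
Lemma uniform_modulus_ex x (C : R) : (forall i, `|x i| <= C) ->
  (forall k (r : 'I_k.+1 -> R), exists L : R,
    `|\sum_(i < k.+1) r i *: x (l i)| @[l --> increasing_tuples k] --> L) ->
  exists w, uniform_modulus x w.
Proof.
move=> xC hL; suff /choice[w hw] : forall kq : nat * nat, exists N,
    forall (r : 'I_kq.1.+1 -> R) l l', (forall i, `|r i| <= kq.2%:R) ->
    increasing l -> increasing l' -> (N <= l ord0)%N -> (N <= l' ord0)%N ->
    `| `|combo x r l| - `|combo x r l'| | <= kq.2.+1%:R^-1.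
  by exists w => k q; exact: (hw (k, q)).
(* Of the four quarters of the tolerance, two pay for moving the coefficients to a grid point and
   two for comparing [l] with [l'] at that grid point. *)
move=> [k q] /=; pose eps : R := q.+1%:R^-1 / 4.
have eps0 : 0 < eps by rewrite divr_gt0// invr_gt0 ltr0Sn.
(* The mesh [M^-1] is such that rounding the coefficients to the grid changes a norm by at most
   [eps]; see [hM]. *)
pose M := (Num.bound (k.+1%:R * C / eps)).+1.
have M0 : 0 < M%:R :> R by rewrite ltr0Sn.
have C0 : 0 <= C := le_trans (normr_ge0 _) (xC 0%N).
have hM : k.+1%:R * (M%:R^-1 * C) <= eps.
  rewrite mulrCA mulrC ler_pdivrMr// [eps * _]mulrC -ler_pdivrMr//.
  have hb : 0 <= k.+1%:R * C / eps by rewrite divr_ge0 ?mulr_ge0// ltW.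
  apply: le_trans (ltW (archi_boundP hb)) _.
  by rewrite ler_nat leqnSn.
pose s (f : {ffun 'I_k.+1 -> 'I_(2 * q * M).+1}) i : R := (f i)%:R / M%:R - q%:R.
have /choice[N hN] : forall f, exists N, forall l, increasing l ->
    (N <= l ord0)%N -> forall l', increasing l' -> (N <= l' ord0)%N ->
    `| `|combo x (s f) l| - `|combo x (s f) l'| | <= eps + eps.
  move=> f; have [L /spreading_limitP/(_ _ eps0)[N hN]] := hL k (s f).
  exists N => l li Nl l' l'i Nl'.
  have -> : `|combo x (s f) l| - `|combo x (s f) l'| =
    (L - `|combo x (s f) l'|) - (L - `|combo x (s f) l|) by ring.
  by apply: le_trans (ler_normB _ _) (lerD (hN _ _ _) (hN _ _ _)).
exists (\max_f N f) => r l l' rq li l'i Nl Nl'.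
have /choice[g hg] := fun i => @grid_approx q M (r i) (ltn0Sn _) (rq i).
pose f := [ffun i => g i].
have rs i : `|r i - s f i| <= M%:R^-1 by rewrite /s ffunE; exact: hg.
have Nf j : (\max_f N f <= j)%N -> (N f <= j)%N.
  by apply: leq_trans; exact: (leq_bigmax f).
have h1 := le_trans (combo_dist l xC rs) hM.
have h2 := le_trans (combo_dist l' xC rs) hM.
have h3 := hN f l li (Nf _ Nl) l' l'i (Nf _ Nl').
have e4 : q.+1%:R^-1 = eps + eps + (eps + eps) 
  by rewrite /eps; move: (q.+1%:R^-1) => u; lra.
move: h1 h2 h3; rewrite e4 !ler_norml => /andP[? ?] /andP[? ?] /andP[? ?].
by apply/andP; split; lra.
Qed.

Lemma admissible_ex x rho : generates_spreading_model x rho ->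
  exists K w, admissible x K w.
Proof.
move=> [[c [C [c0 cC xcC]]] bx xrho].
have [K K0 hK] := basic_sequence_constant bx.
have xc i : c <= `|x i| by have /andP[/ltW] := xcC i.
have xC i : `|x i| <= C by have /andP[_ /ltW] := xcC i.
have [|w hw] := uniform_modulus_ex xC.
  by move=> k r; eexists; exact: xrho.
pose B := Num.bound (c^-1 + C + K).
have C0 : 0 < C := lt_trans c0 cC.
have BB : c^-1 + C + K <= B.+1%:R.
  apply: le_trans (ltW (archi_boundP _)) _; last by rewrite ler_nat leqnSn.
  by rewrite !addr_ge0 ?invr_ge0 ?ltW.
have ci0 : 0 < c^-1 by rewrite invr_gt0.
exists B, w; split=> // [i|a m n mn].
  apply/andP; split; last by apply: le_trans (xC i) _; lra.
  apply: le_trans (xc i); rewrite -[leRHS]invrK lef_pV2 ?posrE ?ltr0Sn//; lra.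
by apply: le_trans (hK a m n mn) _; rewrite ler_wpM2r//; lra.
Qed.

(** The sum runs one index past the last coefficient so that it is indexed by some ['I_k.+1] even
    for the zero polynomial. *)
Lemma poly_sumE p : \sum_(i < (size p).+1) p`_i *: 'X^i = p.
Proof.
by rewrite -[RHS]coefK poly_def big_ord_recr /= nth_default// scale0r addr0.
Qed.

Lemma lin_comb_sum x k (r : 'I_k.+1 -> R) :
  lin_comb x (\sum_(i < k.+1) r i *: 'X^i) = \sum_(i < k.+1) r i *: x i.
Proof.
have -> : \sum_(i < k.+1) r i *: 'X^i = \poly_(i < k.+1) r (inord i).
  by rewrite poly_def; apply: eq_bigr => i _; rewrite inord_val.
by rewrite lin_comb_poly; apply: eq_bigr => i _; rewrite inord_val.
Qed.

Definition shift_seq x N i := x (N + i)%N.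

Lemma increasing_shift k N : increasing (fun i : 'I_k.+1 => N + i)%N.
Proof. by move=> i j ij; rewrite ltn_add2l. Qed.

Lemma lin_comb_shift x N k (r : 'I_k.+1 -> R) :
  lin_comb (shift_seq x N) (\sum_(i < k.+1) r i *: 'X^i) =
  combo x r (fun i => N + i)%N.
Proof. by rewrite lin_comb_sum. Qed.

Lemma coef_le_nat k (r : 'I_k -> R) (m : nat) :
  exists2 q, (m <= q)%N & forall i, `|r i| <= q%:R.
Proof.
exists (m + \sum_i Num.bound `|r i|)%N; first exact: leq_addr.
move=> i; apply: le_trans (ltW (archi_boundP (normr_ge0 (r i)))) _.
by rewrite ler_nat (bigD1 i)//= addnCA leq_addr.
Qed.

Lemma inv_nat_small (eps : R) : 0 < eps ->
  exists m, forall q, (m <= q)%N -> q.+1%:R^-1 <= eps.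
Proof.
move=> e0; exists (Num.bound eps^-1) => q mq.
rewrite -[leRHS]invrK lef_pV2 ?posrE ?ltr0Sn ?invr_gt0//.
have ei : 0 <= eps^-1 by rewrite invr_ge0 ltW.
by apply: le_trans (ltW (archi_boundP ei)) _; rewrite ler_nat leqW.
Qed.

(** The norm [rho p] is obtained as the limit along the consecutive tuples [N, N + 1, ...], which
    exists by the modulus; the modulus then compares every other increasing tuple with these. *)
Lemma admissible_generates x K w : admissible x K w ->
  exists rho, generates_spreading_model x rho.
Proof.
move=> [xK bK xw].
have /choice[rho hrho] : forall p, exists L : R^o,
    (fun N => `|lin_comb (shift_seq x N) p| : R^o) @ \oo --> L.
  move=> p; apply: cauchy_seq_cvg => eps e0.
  have [m hm] := inv_nat_small e0.
  have [q mq hq] := coef_le_nat (fun i : 'I_(size p).+1 => p`_i) m.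
  exists (w (size p, q)) => M N wM wN; apply: le_trans (hm _ mq).
  rewrite -(poly_sumE p) !lin_comb_shift.
  by apply: xw => //; rewrite /= ?addn0//; exact: increasing_shift.
exists rho; split.
(* Passing from [K.+1] to [K.+2] makes the bounds strict, and keeps them distinct even when [K] is
   zero. *)
- exists (K.+2%:R^-1), K.+2%:R; split.
  + by rewrite invr_gt0 ltr0Sn.
  + apply: (@lt_trans _ _ 1); last by rewrite ltr1n.
    by rewrite invf_lt1 ?ltr0Sn// ltr1n.
  + move=> i; have /andP[h1 h2] := xK i; apply/andP; split.
      by apply: lt_le_trans h1; rewrite ltf_pV2 ?posrE ?ltr0Sn// ltr_nat.
    by apply: le_lt_trans h2 _; rewrite ltr_nat.
- apply: (@basic_of_constant _ _ x K.+1%:R^-1 K.+1%:R) => // i.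
  by have /andP[] := xK i.
move=> k r; apply/spreading_limitP => eps e0.
have [m hm] := inv_nat_small e0; have [q mq hq] := coef_le_nat r m.
exists (w (k, q)) => l li wl; apply: le_trans (hm _ mq); rewrite distrC.
apply: (cvg_norm_le (N := w (k, q)) (hrho _)) => n wn; rewrite lin_comb_shift.
by apply: xw => //; rewrite /= ?addn0//; exact: increasing_shift.
Qed.

(** The modulus locates a finite combination whose norm approximates [rho p] at an index depending
    on [w] alone, hence common to all sequences sharing that value of [w]. *)
Lemma spreading_modulus x w rho p q N : generates_spreading_model x rho ->
  uniform_modulus x w -> (forall i : 'I_(size p).+1, `|p`_i| <= q%:R) ->
  (w (size p, q) <= N)%N ->
  `|rho p - `|lin_comb (shift_seq x N) p| | <= q.+1%:R^-1.
Proof.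
move=> [_ _ /(_ (size p) (fun i => p`_i))]; rewrite poly_sumE.
move=> /spreading_limitP hL xw pq wN.
rewrite -[in lin_comb _ _](poly_sumE p) lin_comb_shift.
apply/ler_addgt0Pr => eps /hL[M hM].
pose M' := maxn M N.
have h1 : `|rho p - `|combo x (fun i : 'I_(size p).+1 => p`_i) (fun i => M' + i)%N| | <= eps.
  by apply: hM; [exact: increasing_shift|rewrite addn0 leq_maxl].
have h2 := xw _ _ _ _ _ pq (@increasing_shift (size p) M') (@increasing_shift _ N) _ _.
have {h2} := h2 _ _; rewrite !addn0 leq_max wN orbT => /(_ isT isT) h2.
rewrite [leRHS]addrC; apply: (le_trans _ (lerD h1 h2)); exact: ler_distD.
Qed.

Lemma spreading_ge0 x rho p : generates_spreading_model x rho -> 0 <= rho p.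
Proof.
move=> [_ _ /(_ (size p) (fun i => p`_i))]; rewrite poly_sumE => /spreading_limitP h.
apply/ler_addgt0Pr => eps /h[N /(_ (fun i => N + i)%N)].
rewrite addn0 leqnn => /(_ (@increasing_shift _ _) isT).
rewrite ler_norml => /andP[h1 _]; rewrite -lerBlDr sub0r.
by apply: le_trans h1 _; rewrite gerBl.
Qed.

End SpreadingCodes.

(** * The dichotomy under a closed condition on the generating sequence *)

Section SpreadingDichotomy.
Variables (R : realType) (X : completeNormedModType R).
Implicit Types (x : nat -> X) (p : {poly R}) (rho sigma : {poly R} -> R).

Lemma cvg_le_eventually (u v : nat -> R) (a b : R) N :
  u @ \oo --> a -> v @ \oo --> b -> (forall n, (N <= n)%N -> u n <= v n) -> a <= b.
Proof. by move=> ua vb uv; apply: (ler_cvg_to ua vb); exists N. Qed.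

Lemma cvg_combo (x_ : nat -> nat -> X) x k (r : 'I_k.+1 -> R) l :
  (forall i, x_ ^~ i @ \oo --> x i) ->
  (fun j => combo (x_ j) r l) @ \oo --> combo x r l.
Proof.
move=> xx; rewrite /combo; apply: cvg_big => [|i _]; first exact: add_continuous.
exact: cvgZl_tmp.
Qed.

Lemma cvg_partial_sum_vectors (x_ : nat -> nat -> X) x (a : nat -> R) n :
  (forall i, x_ ^~ i @ \oo --> x i) ->
  (fun j => partial_sum (x_ j) a n) @ \oo --> partial_sum x a n.
Proof.
move=> xx; rewrite /partial_sum; apply: cvg_big => [|i _]; first exact: add_continuous.
exact: cvgZl_tmp.
Qed.

Lemma admissible_closed (x_ : nat -> nat -> X) x (K_ : nat -> nat) K w_ w :
  (forall i, x_ ^~ i @ \oo --> x i) ->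
  (exists N, forall j, (N <= j)%N -> K_ j = K) ->
  (forall kq, exists N, forall j, (N <= j)%N -> w_ j kq = w kq) ->
  (forall j, admissible (x_ j) (K_ j) (w_ j)) -> admissible x K w.
Proof.
move=> xx [N KN] ww adm.
have normx i : (fun j => `|x_ j i|) @ \oo --> `|x i| by apply: cvg_norm; exact: xx.
split.
- move=> i; apply/andP; split.
    apply: (cvg_le_eventually (N := N) (cvg_cst _) (normx i)) => j Nj.
    by have [/(_ i)/andP[+ _] _ _] := adm j; rewrite KN.
  apply: (cvg_le_eventually (N := N) (normx i) (cvg_cst _)) => j Nj.
  by have [/(_ i)/andP[_ +] _ _] := adm j; rewrite KN.
- move=> a m n mn; have sn l :
      (fun j => `|partial_sum (x_ j) a l|) @ \oo --> `|partial_sum x a l|.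
    by apply: cvg_norm; exact: cvg_partial_sum_vectors.
  apply: (cvg_le_eventually (N := N) (sn m) (cvgM (cvg_cst (K.+1%:R : R)) (sn n))) => j Nj.
  by have [_ + _] := adm j; rewrite KN//; apply.
- move=> k q r l l' rq li l'i wl wl'; have [M hM] := ww (k, q).
  have sl l0 : (fun j => `|combo (x_ j) r l0|) @ \oo --> `|combo x r l0|.
    by apply: cvg_norm; exact: cvg_combo.
  apply: (cvg_le_eventually (N := M) (cvg_norm (cvgB (sl l) (sl l'))) (cvg_cst _)) => j Mj.
  by have [_ _] := adm j; apply => //; rewrite hM.
Qed.

(** The moduli are eventually equal at [(size p, q)], so one shift [M] serves for [rho p] and for
    almost all [rho_ j p]. At that shift only finitely many vectors are involved, and their
    combination is continuous. *)
Lemma spreading_continuous (x_ : nat -> nat -> X) x w_ w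
    (rho_ : nat -> {poly R} -> R) rho p :
  (forall i, x_ ^~ i @ \oo --> x i) ->
  (forall kq, exists N, forall j, (N <= j)%N -> w_ j kq = w kq) ->
  (forall j, uniform_modulus (x_ j) (w_ j)) -> uniform_modulus x w ->
  (forall j, generates_spreading_model (x_ j) (rho_ j)) ->
  generates_spreading_model x rho -> rho_ ^~ p @ \oo --> rho p.
Proof.
move=> xx ww xw_ xw gx_ gx; apply/cvg_seqP => eps e0.
have e3 : 0 < eps / 3 by rewrite divr_gt0.
have [m hm] := inv_nat_small e3.
have [q mq hq] := coef_le_nat (fun i : 'I_(size p).+1 => p`_i) m.
have [N hN] := ww (size p, q); pose M := w (size p, q).
have : (fun j => `|lin_comb (shift_seq (x_ j) M) p|) @ \oo --> `|lin_comb (shift_seq x M) p|.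
  apply: cvg_norm; rewrite -(poly_sumE p).
  under eq_cvg do rewrite lin_comb_shift.
  by rewrite lin_comb_shift; exact: cvg_combo.
move=> /cvg_seqP/(_ _ e3)[L hL]; exists (maxn N L) => j; rewrite geq_max => /andP[Nj Lj].
have h1 := le_trans (spreading_modulus gx xw hq (leqnn _)) (hm _ mq).
have h2 : `|rho_ j p - `|lin_comb (shift_seq (x_ j) M) p| | <= eps / 3.
  by apply: le_trans (spreading_modulus (gx_ j) (xw_ j) hq _) (hm _ mq); rewrite hN.
have h3 := hL j Lj.
rewrite (_ : eps = eps / 3 + (eps / 3 + eps / 3)); last by lra.
rewrite distrC in h2.
apply: le_trans (ler_distD `|lin_comb (shift_seq x M) p| _ _) _; apply: lerD => //.
by apply: le_trans (ler_distD `|lin_comb (shift_seq (x_ j) M) p| _ _) _; apply: lerD.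
Qed.

Definition equivalent_le n rho sigma := forall p,
  rho p <= n.+1%:R * sigma p /\ sigma p <= n.+1%:R * rho p.

Lemma equivalentP rho sigma : (forall p, 0 <= rho p) -> (forall p, 0 <= sigma p) ->
  equivalent rho sigma <-> exists n, equivalent_le n rho sigma.
Proof.
move=> rho0 sigma0; split=> [[C [C1 hC]]|[n hn]].
  have C0 : 0 < C by apply: lt_le_trans C1.
  have hb : C <= (Num.bound C).+1%:R.
    by apply: le_trans (ltW (archi_boundP (ltW C0))) _; rewrite ler_nat.
  exists (Num.bound C) => p; have /andP[h1 h2] := hC p; split.
    by rewrite mulrC ler_pdivrMr// mulrC in h1; apply: le_trans h1 _; exact: ler_wpM2r.
  by apply: le_trans h2 _; exact: ler_wpM2r.
exists n.+1%:R; split=> [|p]; first by rewrite ler1n.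
by have [h1 h2] := hn p; rewrite h2 andbT mulrC ler_pdivrMr ?ltr0Sn// mulrC.
Qed.

Lemma equivalent_le_trans m n rho sigma tau : equivalent_le m rho sigma ->
  equivalent_le n sigma tau -> exists k, equivalent_le k rho tau.
Proof.
move=> h h'; exists (m.+1 * n.+1).-1 => p; have [h1 h2] := h p; have [h3 h4] := h' p.
rewrite prednK ?muln_gt0// natrM; split.
  by apply: le_trans h1 _; rewrite -mulrA ler_wpM2l.
by apply: le_trans h4 _; rewrite [_ * n.+1%:R]mulrC -mulrA ler_wpM2l.
Qed.

(** [A x v] is an additional requirement on the generating sequence together with its witnesses [v]:
    void for all spreading models, a modulus of weak nullness, or the supports of blocks. *)
Theorem spreading_dichotomy (J : countType)
    (A : (nat -> X) -> (J -> nat) -> Prop) :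
  separable X ->
  (forall (x_ : nat -> nat -> X) v_ x v, cvg_param x_ v_ x v ->
    (forall k, A (x_ k) (v_ k)) -> A x v) ->
  dichotomy [set rho | exists x, (exists v, A x v) /\ generates_spreading_model x rho].
Proof.
move=> sepX A_closed; set S := [set rho | _].
(* The entry [inl None] holds the constant [K], the entries [inl (Some kq)] the modulus, and the
   entries [inr j] the witnesses for [A]. *)
pose P x (w : option (nat * nat) + J -> nat) rho :=
  [/\ admissible x (w (inl None)) (fun kq => w (inl (Some kq))),
      A x (fun j => w (inr j)) & generates_spreading_model x rho].
have SP : S = [set rho | exists x w, P x w rho].
  apply/seteqP; split=> rho [x].
    move=> [[v Av] gx]; have [K [w adm]] := admissible_ex gx.
    exists x, (fun i => match i with
      | inl None => K | inl (Some kq) => w kq | inr j => v j end).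
    by split.
  by move=> [w [_ Aw gx]]; exists x; split=> //; exists (fun j => w (inr j)).
have S0 rho : S rho -> forall p, 0 <= rho p.
  by move=> [x [_ gx]] p; exact: spreading_ge0 gx.
have := @coded_dichotomy R X (option (nat * nat) + J)%type _ P equivalent_le sepX.
case=> [|||||[phi [Sphi hphi]]|h].
- move=> x_ w_ t_ x w [xx ww] hP.
  have adm : admissible x (w (inl None)) (fun kq => w (inl (Some kq))).
    apply: (admissible_closed xx (ww (inl None)) (fun kq => ww (inl (Some kq)))) => j.
    by have [] := hP j.
  have [rho grho] := admissible_generates adm; exists rho; split=> //.
  apply: (A_closed x_ (fun k j => w_ k (inr j))).
    by split=> // j; exact: (ww (inr j)).
  by move=> k; have [] := hP k.
- move=> n x_ w_ t_ x w t y_ v_ u_ y v u [xx ww] hP [[_ _ xw] _ gx]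
    [yy vv] hQ [[_ _ yv] _ gy] E p.
  have ct : t_ ^~ p @ \oo --> t p.
    apply: (spreading_continuous xx (fun kq => ww (inl (Some kq))) _ xw _ gx) => j.
      by have [[]] := hP j.
    by have [] := hP j.
  have cu : u_ ^~ p @ \oo --> u p.
    apply: (spreading_continuous yy (fun kq => vv (inl (Some kq))) _ yv _ gy) => j.
      by have [[]] := hQ j.
    by have [] := hQ j.
  split.
    apply: (cvg_le_eventually (N := 0) ct (cvgM (cvg_cst (n.+1%:R : R)) cu)) => j _.
    exact: (E j p).1.
  apply: (cvg_le_eventually (N := 0) cu (cvgM (cvg_cst (n.+1%:R : R)) ct)) => j _.
  exact: (E j p).2.
- rewrite -SP => m n t u /S0 t0 /S0 u0 mn E p; have [h1 h2] := E p.
  have mnR : m.+1%:R <= n.+1%:R :> R by rewrite ler_nat.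
  by split; [apply: le_trans h1 _|apply: le_trans h2 _]; exact: ler_wpM2r.
- by move=> n t u E p; have [] := E p.
- by move=> t u v _ _ _ [m hm] [n hn]; exact: equivalent_le_trans hm hn.
- rewrite -SP in Sphi; left; exists (range phi); split.
  + by move=> _ [a _ <-]; exact: Sphi.
  + move=> _ _ [a _ <-] [b _ <-] ab /equivalentP h.
    apply: (hphi a b) => [ab'|]; first by apply: ab; rewrite ab'.
    by apply: h; exact: S0.
  (* Equal values would be equivalent with constant one, against the choice of [phi]. *)
  + have phi_inj : injective phi.
      move=> a b ab; apply: contrapT => /hphi; apply; exists 0%N => p.
      by rewrite ab !mul1r.
    apply: card_eq_trans (card_cantor_reals R).
    by apply: inj_card_eq => a b _ _; exact: phi_inj.
- rewrite -SP in h; right => F FS indF; apply: (h _ FS) => t u Ft Fu tu /equivalentP htu.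
  by apply: (indF _ _ Ft Fu tu); apply: htu; apply: S0; exact: FS.
Qed.

End SpreadingDichotomy.

(** * Weakly null and block sequences *)

Section ExtraConditions.
Variables (R : realType) (X : completeNormedModType R).
Implicit Types (x e : nat -> X).

Lemma continuous_linear_le (f : {linear X -> R^o}) : continuous f ->
  exists2 M : R, 0 < M & forall y, `|f y| <= M * `|y|.
Proof.
move=> /linear_bounded_continuous/linear_boundedP fM.
by have [M M0 hM] := pinfty_ex_gt0 fM; exists M.
Qed.

(** Continuity of [f] and [g] bounds the set defining [dual_norm], so that its [sup] is an upper
    bound and not the default value. *)
Lemma le_dual_norm (f g : {linear X -> R^o}) y : continuous f -> continuous g ->
  `|f y - g y| <= dual_norm (f \- g) * `|y|.
Proof.
move=> /continuous_linear_le[M M0 fM] /continuous_linear_le[N N0 gN].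
have [->|y0] := eqVneq y 0; first by rewrite (linear0 f) (linear0 g) subr0 !normr0 mulr0.
have yp : 0 < `|y| by rewrite normr_gt0.
rewrite -ler_pdivrMr//; apply: ub_le_sup.
  exists (M + N) => _ [z /= z1 <-]; apply: le_trans (ler_normB _ _) _.
  apply: lerD; first by apply: le_trans (fM z) _; rewrite ler_piMr// ltW.
  by apply: le_trans (gN z) _; rewrite ler_piMr// ltW.
exists (`|y|^-1 *: y) => /=.
  by rewrite normrZ gtr0_norm ?invr_gt0// mulVf ?gt_eqF.
have -> : f (`|y|^-1 *: y) - g (`|y|^-1 *: y) = `|y|^-1 * (f y - g y).
  by rewrite mulrBr !linearZ.
by rewrite normrM gtr0_norm ?invr_gt0// mulrC.
Qed.

(** Testing only functionals in the countable set [D], numbered by [idx], leaves countably many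
    witnesses. *)
Definition null_modulus (D : set {linear X -> R^o}) (idx : {linear X -> R^o} -> nat)
    x (v : nat * nat -> nat) :=
  forall g, D g -> forall m i, (v (idx g, m) <= i)%N -> `|g (x i)| <= m.+1%:R^-1.

Lemma weakly_null_modulus (D : set {linear X -> R^o}) idx x :
  {in D &, injective idx} -> (forall g, D g -> continuous g) ->
  weakly_null x -> exists v, null_modulus D idx x v.
Proof.
move=> idxI Dc x0.
have /choice[v hv] : forall nm : nat * nat, exists N, forall g, D g ->
    idx g = nm.1 -> forall i, (N <= i)%N -> `|g (x i)| <= nm.2.+1%:R^-1.
  move=> [n m] /=; have [[g [Dg gn]]|no] := pselect (exists g, D g /\ idx g = n); last first.
    by exists 0%N => g Dg gn; case: no; exists g.
  have [|N hN] := (cvg_seqP _ _).1 (x0 g (Dc _ Dg)) m.+1%:R^-1.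
    by rewrite invr_gt0 ltr0Sn.
  exists N => g' Dg' g'n i Ni; have := hN i Ni; rewrite sub0r normrN.
  by rewrite (idxI g g')// ?inE// gn g'n.
by exists v => g Dg m i; exact: (hv (idx g, m)).
Qed.

(** On a bounded sequence, replacing [f] by a close [g] in [D] changes the values uniformly little;
    half of [eps] pays for this, half for the modulus of [g]. *)
Lemma null_modulus_weakly_null (D : set {linear X -> R^o}) idx x v (C : R) :
  (forall g, D g -> continuous g) ->
  (forall f : {linear X -> R^o}, continuous f -> forall eps : R, 0 < eps ->
    exists2 g, D g & dual_norm (f \- g) < eps) ->
  (forall i, `|x i| <= C) -> null_modulus D idx x v -> weakly_null x.
Proof.
move=> Dc Dd xC xv f fc; apply/cvg_seqP => eps e0.
have C0 : 0 <= C := le_trans (normr_ge0 _) (xC 0%N).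
have C1 : 0 < C + 1 by rewrite ltr_wpDl.
have e2 : 0 < eps / 2 by rewrite divr_gt0.
have [g Dg fg] := Dd f fc _ (divr_gt0 e2 C1).
have [m /(_ m (leqnn _)) hm] := inv_nat_small e2.
exists (v (idx g, m)) => n vn; rewrite sub0r normrN.
rewrite -(subrK (g (x n)) (f (x n))) [eps]splitr.
apply: le_trans (ler_normD _ _) _; apply: lerD; last exact: le_trans (xv _ Dg _ _ vn) hm.
apply: le_trans (le_dual_norm _ fc (Dc _ Dg)) _.
apply: (@le_trans _ _ (eps / 2 / (C + 1) * (C + 1))); last by rewrite divfK// gt_eqF.
apply: le_trans (ler_wpM2r _ (ltW fg)) _ => //.
by rewrite ler_wpM2l ?divr_ge0 ?ltW//; apply: le_lt_trans (xC n) _; rewrite ltrDl.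
Qed.

Lemma null_modulus_closed (D : set {linear X -> R^o}) idx
    (x_ : nat -> nat -> X) v_ x v :
  (forall g, D g -> continuous g) -> cvg_param x_ v_ x v ->
  (forall k, null_modulus D idx (x_ k) (v_ k)) -> null_modulus D idx x v.
Proof.
move=> Dc [xx vv] h g Dg m i vi; have [N hN] := vv (idx g, m).
have gx : (fun k => `|g (x_ k i)|) @ \oo --> `|g (x i)|.
  by apply: cvg_norm; apply: continuous_cvg (xx i); exact: Dc.
apply: (cvg_le_eventually (N := N) gx (cvg_cst _)) => k Nk.
by apply: h => //; rewrite hN.
Qed.

Theorem weakly_null_dichotomy : separable X -> separable_dual X ->
  dichotomy (weakly_null_spreading_models X).
Proof.
move=> sepX [D [/countable_injP[idx idxI] Dc Dd]].
have := @spreading_dichotomy R X _ (null_modulus D idx) sepX.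
rewrite (_ : [set rho | _] = weakly_null_spreading_models X).
  by apply => x_ v_ x v; exact: null_modulus_closed.
apply/seteqP; split=> rho [x [xw gx]]; exists x; split=> //.
  have [v xv] := xw; have [[c [C [_ _ xC]]] _ _] := gx.
  by apply: (null_modulus_weakly_null (C := C) Dc Dd _ xv) => i; have /andP[_ /ltW] := xC i.
exact: weakly_null_modulus.
Qed.

(** Fixing the intervals [[v n, v n.+1)] turns succession of supports into a condition that is
    closed in [x]. *)
Definition supported_between e x (v : nat -> nat) := forall n a,
  partial_sum e a @ \oo --> x n ->
  forall i, ~~ (v n <= i < v n.+1)%N -> a i = 0.

(** * Block sequences of a Schauder basis *)

Section Block.
Variable e : nat -> X.
Hypothesis e_basis : schauder_basis e.

Let expansion (y : X) : exists! a, partial_sum e a @ \oo --> y.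
Proof.
have [a [ay au]] := e_basis.2 y I; exists a.
by split=> [|b]; rewrite -series_partial_sum// => /au.
Qed.

(** Coordinate functionals are continuous: the basis constant [K] gives
    [|a i| * |e i| <= 2 * K * |x n - x_ k n|] once the [i]-th coordinate of [x_ k n] vanishes. *)
Lemma supported_between_closed (x_ : nat -> nat -> X) v_ x v :
  cvg_param x_ v_ x v -> (forall k, supported_between e (x_ k) (v_ k)) ->
  supported_between e x v.
Proof.
move=> [xx vv] h n a ax i ni.
have Ylin (c : R) (u w : X) : [set: X] u -> [set: X] w -> [set: X] (c *: u + w) by [].
have [K K0 hK] := basis_constant (@closedT X) Ylin e_basis.
have ei : 0 < `|e i| by rewrite normr_gt0; exact: (basis_neq0 Ylin e_basis).
suff : `|a i| * `|e i| <= 0 by rewrite pmulr_lle0// normr_le0 => /eqP.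
apply/ler_addgt0Pr => eps e0; rewrite add0r.
have K2 : 0 < 2 * K by rewrite mulr_gt0.
have [M hM] := (cvg_seqP _ _).1 (xx n) _ (divr_gt0 e0 K2).
have [N1 hN1] := vv n; have [N2 hN2] := vv n.+1.
pose k := maxn M (maxn N1 N2); have [b [bx _]] := expansion (x_ k n).
have bi : b i = 0.
  by apply: (h k n b bx); rewrite hN1 ?hN2// !leq_max leqnn ?orbT.
have := @coef_bound _ _ e (fun j => a j - b j) (K * `|x n - x_ k n|) _ i.
rewrite bi subr0; move=> hc; apply: le_trans (hc _) _; last first.
  by rewrite mulrA mulrC -ler_pdivlMr//; apply: hM; exact: leq_maxl.
apply: hK => //; rewrite (_ : partial_sum e _ = partial_sum e a \- partial_sum e b).
  exact: cvgB.
by apply/funext => j; rewrite partial_sumB.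
Qed.

(** Take for [v n] the least index in the support of the [n]-th block: the support of that block
    ends before [v n.+1]. *)
Lemma block_supported x : block_sequence e x -> exists v, supported_between e x v.
Proof.
move=> [b [xb x0 bsucc]].
have /choice[v hv] : forall n, exists j, (b n)`_j != 0 /\
    forall i, (b n)`_i != 0 -> (j <= i)%N.
  move=> n; have bn : exists i, (b n)`_i != 0.
    exists (size (b n)).-1; rewrite -lead_coefE lead_coef_eq0.
    by apply: contraNneq (x0 n) => b0; rewrite xb b0 /lin_comb size_poly0 big_ord0.
  by exists (ex_minn bn); case: ex_minnP.
exists v => n a ax i; apply: contraNeq => ai0.
have [c [_ cu]] := expansion (x n).
have ab : a = (fun j => (b n)`_j).
  rewrite -(cu a ax); apply: cu; apply/cvg_seqP => eps e0; exists (size (b n)) => m bm.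
  by rewrite xb (lin_comb_partial_sum _ bm) subrr normr0 ltW.
rewrite ab in ai0; rewrite (hv n).2//=.
by apply: (bsucc n i) => //; exact: (hv n.+1).1.
Qed.

(** The expansion of [x n] vanishes from [v n.+1] on, so it is a finite sum, given by a
    polynomial. *)
Lemma supported_block x v : (forall n, x n != 0) -> supported_between e x v ->
  block_sequence e x.
Proof.
move=> x0 xv; have /choice[a ha] : forall n, exists a, partial_sum e a @ \oo --> x n.
  by move=> n; have [a [ax _]] := expansion (x n); exists a.
have a0 n i : ~~ (v n <= i < v n.+1)%N -> a n i = 0 by exact: xv.
exists (fun n => \poly_(i < v n.+1) a n i); split=> // [n|n i j].
  rewrite lin_comb_poly; suff h : partial_sum e (a n) @ \oo --> partial_sum e (a n) (v n.+1).
    exact: (cvg_unique _ (ha n) h).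
  apply/cvg_seqP => eps e0; exists (v n.+1) => m vm.
  suff -> : partial_sum e (a n) m = partial_sum e (a n) (v n.+1).
    by rewrite subrr normr0 ltW.
  rewrite -[in RHS](minn_idPr vm) -partial_sum_trunc; apply: partial_sum_eq => i _.
  by case: ltnP => // vi; rewrite a0// negb_and -leqNgt vi orbT.
rewrite !coef_poly; case: ltnP => [iv _|_]; last by rewrite eqxx.
apply: contraNT; rewrite -leqNgt => ji; case: ifP => // _.
by apply/eqP; apply: a0; rewrite negb_and -ltnNge (leq_ltn_trans ji iv).
Qed.

Theorem block_dichotomy : separable X -> dichotomy (block_spreading_models e).
Proof.
move=> sepX; have := @spreading_dichotomy R X _ (supported_between e) sepX.
rewrite (_ : [set rho | _] = block_spreading_models e).
  by apply => x_ v_ x v; exact: supported_between_closed.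
apply/seteqP; split=> rho [x [xw gx]]; exists x; split=> //.
  have [v xv] := xw; have [[c [C [c0 _ xC]]] _ _] := gx.
  apply: supported_block xv => n; rewrite -normr_gt0.
  by have /andP[/(lt_trans c0)] := xC n.
exact: block_supported.
Qed.

End Block.

End ExtraConditions.

Theorem proposition9 (R : realType) (X : completeNormedModType R)
    (hX : separable X) :
  [/\ dichotomy (spreading_models X),
      separable_dual X -> dichotomy (weakly_null_spreading_models X)
    & forall e : nat -> X, schauder_basis e ->
        dichotomy (block_spreading_models e)].
Proof.
split; last by move=> e e_basis; exact: block_dichotomy.
  have := @spreading_dichotomy R X unit (fun _ _ => True) hX.
  rewrite (_ : [set rho | _] = spreading_models X); first exact.
  apply/seteqP; split=> rho [x]; first by move=> [_ gx]; exists x.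
  by move=> gx; exists x; split=> //; exists (fun=> 0%N).
exact: weakly_null_dichotomy.
Qed.
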